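(* Let $\mathbf r=(r_0,r_1)\in\mathbb Z_{\ge0}^2$, $J_0=\{1,\dots,r_0\}$, $J_1=\{r_0+1,\dots,r_0+r_1\}$. Then $$Z^{\mathbf r}_{+\mathrm{fund}}(q,\mathbf e,\boldsymbol\mu;p)=\sum_{n\ge0}\ \sum_{\substack{\mathbf k\in\mathbb Z_{\ge0}^{J_1}\\|\mathbf k|=n}}\Big(-p\,q^{\frac{n+1}2}\prod_{\alpha\in J_0}\frac q{e_\alpha\mu_\alpha}\Big)^n\frac{\Delta_{J_1}(q^{\mathbf k}\mathbf e)}{\Delta_{J_1}(\mathbf e)}\prod_{\alpha,\beta\in J_1}\frac{(e_\beta\mu_\alpha;q)_{k_\beta}}{(qe_\beta/e_\alpha;q)_{k_\beta}}\prod_{\beta\in J_1,\,\alpha\in J_0}\frac{(e_\beta\mu_\alpha;q)_{k_\beta}}{(qe_\beta/e_\alpha;q)_{k_\beta}},$$ $$Z^{\mathbf r}_{-\mathrm{fund}}(q,\mathbf e,\boldsymbol\mu;p)=\sum_{n\ge0}\ \sum_{\substack{\mathbf k\in\mathbb Z_{\ge0}^{J_0}\\|\mathbf k|=n}}\Big(-p\,q^{\frac{n+1}2}\prod_{\alpha\in J_1}e_\alpha\mu_\alpha\Big)^n\frac{\Delta_{J_0}(q^{\mathbf k}\mathbf e^{-1})}{\Delta_{J_0}(\mathbf e^{-1})}\prod_{\alpha,\beta\in J_0}\frac{(q/e_\beta\mu_\alpha;q)_{k_\beta}}{(qe_\alpha/e_\beta;q)_{k_\beta}}\prod_{\beta\in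 J_0,\,\alpha\in J_1}\frac{(q/e_\beta\mu_\alpha;q)_{k_\beta}}{(qe_\alpha/e_\beta;q)_{k_\beta}}.$$
   Context: $(x;q)_k=\prod_{i=0}^{k-1}(1-q^ix)$; $|\mathbf k|=\sum_\alpha k_\alpha$; $\Delta_K(x)=\prod_{\alpha<\beta,\ \alpha,\beta\in K}(x_\alpha-x_\beta)$; $q^{\mathbf k}\mathbf e=(q^{k_\alpha}e_\alpha)_\alpha$, $q^{\mathbf k}\mathbf e^{-1}=(q^{k_\alpha}e_\alpha^{-1})_\alpha$. Handsaw quiver varieties of type $A_1$: let $r=r_0+r_1$, $V=\mathbb C^n$, $W_0=\bigoplus_{\alpha\in J_0}\mathbb C_{e_\alpha}$, $W_1=\bigoplus_{\alpha\in J_1}\mathbb C_{e_\alpha}$, and consider triples $(B,z,w)\in\mathrm{End}(V)\times\mathrm{Hom}(W_0,V)\times\mathrm{Hom}(V,W_1)$ (no relation), with $GL(V)$ acting naturally. $M^-(\mathbf r,n)$ is the quotient by $GL(V)$ of the locus where no proper $B$-stable subspace of $V$ contains $\mathrm{im}\,z$; $M^+(\mathbf r,n)$ is the quotient of the locus where no nonzero $B$-stable subspace is contained in $\ker w$. The torus with coordinates $q,\mathbf e=(e_1,\dots,e_r),\boldsymbol\mu=(\mu_1,\dots,\mu_r)$ acts via the weights in $\mathrm{End}(V)\otimes\mathbb C_q\times\mathrm{Hom}(W_0,V)\times\mathrm{Hom}(V,W_1)\otimes\mathbb C_q$, i.e. $(B,z,w)\mapsto(qB,ze^{-1},q\,e\,w)$,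 with $\boldsymbol\mu$ acting trivially. These spaces $M$ are smooth with finitely many torus-fixed points. With $\mathcal V$ the tautological bundle, $$\Lambda_{\mathrm{fund}}=\bigoplus_{\alpha=1}^{r_0}\mathcal V\otimes\mathbb C_{\mu_\alpha/q}+\bigoplus_{\alpha=r_0+1}^r\mathcal V^\vee\otimes\mathbb C_{q/\mu_\alpha}.$$ For a sum of characters put $\mathrm{Eu}_K(\sum n_ww)=\prod(1-w^{-1})^{n_w}$; the $K$-theoretic integral is $\int_M^{[K]}\mathrm{Eu}_K(\Lambda)=\sum_{x\in M^{\mathbb T}}\mathrm{Eu}_K(\Lambda|_x)/\mathrm{Eu}_K(T_xM)$ (equivariant Euler characteristic of $\wedge_{-1}\Lambda^\vee$, by localization), and $Z^{\mathbf r}_{\pm\mathrm{fund}}(q,\mathbf e,\boldsymbol\mu;p)=\sum_{n\ge0}p^n\int^{[K]}_{M^\pm(\mathbf r,n)}\mathrm{Eu}_K(\Lambda_{\mathrm{fund}})$. *)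

(* Defs.v *)
From HB Require Import structures.
From mathcomp Require Import all_boot all_order all_algebra.
From mathcomp Require Import boolp classical_sets fsbigop.
From mathcomp Require Import mpoly.

Set Implicit Arguments.
Unset Strict Implicit.
Unset Printing Implicit Defensive.

Import GRing.Theory Num.Theory.
Local Open Scope ring_scope.
Local Open Scope classical_set_scope.

(* Torus coordinates (q, e_1 .. e_r, mu_1 .. mu_r), all ranging over one index
   type.  With r = r0 + r1, J_0 is the image of lshift r1 : 'I_r0 -> 'I_r and
   J_1 is the image of rshift r0 : 'I_r1 -> 'I_r. *)
Definition tdim (r : nat) : nat := (1 + (r + r))%N.
Definition iq (r : nat) : 'I_(tdim r) := lshift (r + r) ord0.
Definition ie (r : nat) (a : 'I_r) : 'I_(tdim r) := rshift 1 (lshift r a).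
Definition imu (r : nat) (a : 'I_r) : 'I_(tdim r) := rshift 1 (rshift r a).

Definition torus (C : fieldType) (m : nat) : set ('I_m -> C) :=
  [set t | forall i, t i != 0].

(* The character lattice Z^m, written additively: chi is the Laurent monomial
   \prod_i x_i ^ (chi i). *)
Definition char (m : nat) := {ffun 'I_m -> int}.

Definition coord_char (m : nat) (i : 'I_m) : char m :=
  [ffun j => (i == j)%:Z].

Definition char_eval (F : fieldType) (m : nat) (x : 'I_m -> F) (chi : char m)
  : F := \prod_i x i ^ chi i.

(* The field Q(x_1, .., x_m) in which K-theoretic integrals take their values. *)
Definition ratfun (m : nat) : fieldType := {fraction {mpoly rat[m]}}.

Definition tvar (m : nat) (i : 'I_m) : ratfun m :=
  FracField.tofrac ('X_i : {mpoly rat[m]}).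

(* A class "\sum_w n_w w" is given by its multiplicities w |-> n_w. *)
Definition kclass (m : nat) := char m -> int.

Definition kadd (m : nat) (a b : kclass m) : kclass m := fun w => a w + b w.
Definition ksum (m s : nat) (a : 'I_s -> kclass m) : kclass m :=
  fun w => \sum_i a i w.
Definition kdual (m : nat) (a : kclass m) : kclass m := fun w => a (- w).
(* Tensor product with the one-dimensional representation C_chi. *)
Definition ktwist (m : nat) (a : kclass m) (chi : char m) : kclass m :=
  fun w => a (w - chi).

(* \big[_]_(_ \in setT) is the product over the finitely many w whose factor
   is different from 1. *)
Definition EuK (m : nat) (a : kclass m) : ratfun m :=
  \big[*%R/1]_(w \in [set: char m]) (1 - (char_eval (@tvar m) w)^-1) ^ a w.

Section Weights.
Context (C : fieldType) (m : nat) (U : vectType C).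

Definition indep_mod (S : set U) (k : nat) (u : 'I_k -> U) : Prop :=
  forall c : 'I_k -> C, S (\sum_i c i *: u i) -> forall i, c i = 0.

Definition weight_mod (S : set U) (act : ('I_m -> C) -> U -> U) (chi : char m)
  (u : U) : Prop :=
  forall t, torus t -> S (act t u - char_eval t chi *: u).

(* Dimension of the chi-weight space of the quotient representation U / S, for
   a torus-stable subspace S of U: the largest number of weight vectors that
   are linearly independent modulo S. *)
Definition weight_mult (S : set U) (act : ('I_m -> C) -> U -> U)
  (chi : char m) : nat :=
  \max_(k < (dim U).+1 |
     `[< exists u : 'I_k -> U,
          indep_mod S u /\ forall i, weight_mod S act chi (u i) >]) k.

Definition rep_class (S : set U) (act : ('I_m -> C) -> U -> U) : kclass m :=
  fun chi => (weight_mult S act chi)%:Z.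

End Weights.

(* Triples (B, z, w) in End(V) x Hom(W_0, V) x Hom(V, W_1) with V = C^n
   (column vectors). *)
Notation triple C r0 r1 n := ('M[C]_n * 'M[C]_(n, r0) * 'M[C]_(r1, n))%type.

Section Handsaw.
Context (C : numClosedFieldType) (r0 r1 n : nat).
Let r := (r0 + r1)%N.

Implicit Types (X : triple C r0 r1 n) (t : 'I_(tdim r) -> C).

Definition gl_act (g : 'M[C]_n) X : triple C r0 r1 n :=
  (g *m X.1.1 *m invmx g, g *m X.1.2, X.2 *m invmx g).

Definition torus_act t X : triple C r0 r1 n :=
  (t (iq r) *: X.1.1,
   X.1.2 *m diag_mx (\row_(a < r0) (t (ie (lshift r1 a)))^-1),
   t (iq r) *: (diag_mx (\row_(b < r1) t (ie (rshift r0 b))) *m X.2)).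

Definition stable_minus : set (triple C r0 r1 n) :=
  [set X | forall U : {vspace 'cV[C]_n},
     (forall v, v \in U -> X.1.1 *m v \in U) ->
     (forall a : 'cV[C]_r0, X.1.2 *m a \in U) -> U = fullv].

Definition stable_plus : set (triple C r0 r1 n) :=
  [set X | forall U : {vspace 'cV[C]_n},
     (forall v, v \in U -> X.1.1 *m v \in U) ->
     (forall v, v \in U -> X.2 *m v = 0) -> U = 0%VS].

Definition gl_orbit X : set (triple C r0 r1 n) :=
  [set Y | exists2 g, g \in unitmx & Y = gl_act g X].

(* Points of the quotient of st by GL(V) are the GL(V)-orbits in st. *)
Definition gl_quotient (st : set (triple C r0 r1 n))
  : set (set (triple C r0 r1 n)) := [set gl_orbit X | X in st].

Definition torus_fixed (M : set (set (triple C r0 r1 n)))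
  : set (set (triple C r0 r1 n)) :=
  [set O | M O /\ forall t, torus t -> torus_act t @` O = O].

(* When the orbit of X is torus-fixed (and X is stable, so that its stabilizer
   in GL(V) is trivial), this is the unique g in GL(V) with g . (t . X) = X. *)
Definition fix_lift X t : 'M[C]_n :=
  xget 1%:M [set g | g \in unitmx /\ gl_act g (torus_act t X) = X].

(* The tautological bundle is (st x V) / GL(V), with the torus acting by
   t . [X, v] = [t . X, v].  Over a fixed point, [t . X, v] = [X, g v] where
   g = fix_lift X t, so that t acts on the fibre V as g. *)
Definition taut_class X : kclass (tdim r) :=
  rep_class [set 0] (fun t (v : 'cV[C]_n) => fix_lift X t *m v).

(* The tangent space at the orbit of X of the free quotient is the space of all
   triples modulo the image gl(V) . X of the infinitesimal action.  Since
   Y |-> g . (t . Y) is linear and fixes X, it is its own differential at X. *)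
Definition gl_tangent X : set (triple C r0 r1 n) :=
  [set Y | exists xi : 'M[C]_n,
     Y = (xi *m X.1.1 - X.1.1 *m xi, xi *m X.1.2, - (X.2 *m xi))].

Definition tangent_class X : kclass (tdim r) :=
  rep_class (gl_tangent X)
    (fun t (Y : triple C r0 r1 n) => gl_act (fix_lift X t) (torus_act t Y)).

Definition Lambda_fund X : kclass (tdim r) :=
  kadd
    (ksum (fun a : 'I_r0 => ktwist (taut_class X)
       (coord_char (imu (lshift r1 a)) - coord_char (iq r))))
    (ksum (fun a : 'I_r1 => ktwist (kdual (taut_class X))
       (coord_char (iq r) - coord_char (imu (rshift r0 a))))).

(* Sum over torus-fixed points x of Eu_K(Lambda|_x) / Eu_K(T_x M), where
   M = st / GL(V); xget 0 O is a representative of the orbit O. *)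
Definition K_integral (st : set (triple C r0 r1 n))
  (Lambda : triple C r0 r1 n -> kclass (tdim r)) : ratfun (tdim r) :=
  \sum_(O \in torus_fixed (gl_quotient st))
     EuK (Lambda (xget 0 O)) / EuK (tangent_class (xget 0 O)).

End Handsaw.

(* Z_{+fund} and Z_{-fund} as formal power series in p, given by their
   sequences of coefficients. *)
Definition Z_plus_fund (C : numClosedFieldType) (r0 r1 : nat)
  : nat -> ratfun (tdim (r0 + r1)) :=
  fun n => K_integral (@stable_plus C r0 r1 n) (@Lambda_fund C r0 r1 n).

Definition Z_minus_fund (C : numClosedFieldType) (r0 r1 : nat)
  : nat -> ratfun (tdim (r0 + r1)) :=
  fun n => K_integral (@stable_minus C r0 r1 n) (@Lambda_fund C r0 r1 n).

Definition qpoch (F : fieldType) (q x : F) (k : nat) : F :=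
  \prod_(i < k) (1 - q ^+ i * x).

Definition Delta (F : fieldType) (s : nat) (x : 'I_s -> F) : F :=
  \prod_(a < s) \prod_(b < s | (a < b)%N) (x a - x b).

(* Main.v *)
Require Import Defs.
From HB Require Import structures.
From mathcomp Require Import all_boot all_order all_algebra.
From mathcomp Require Import boolp classical_sets fsbigop.
From mathcomp Require Import mpoly.
From mathcomp Require Import zify ring.

(* Let X = (B, z, w) be stable with torus-fixed orbit.  At a torus point t in
   general position, the g in GL(V) with g . (t . X) = X has the vectors B^i z_a
   as eigenvectors, with pairwise distinct eigenvalues q^-i e_a, none of which is
   compatible with w <> 0.  Hence w = 0, the nonzero B^i z_a form a basis of V,
   and the orbit is determined by the lengths k_a of the chains
   z_a, B z_a, B^2 z_a, ... : the fixed points are indexed by the k with |k| = n.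
   The + side is the - side for the transposed triple (B^T, w^T, z^T).

   At the fixed point k the character of V is sum_a sum_(i < k_a) q^-i e_a, and
   in End(V) q - End(V) + Hom(W_0, V) the sum over each chain telescopes, so that
   the tangent space has the weights q^(k_b - i) e_a / e_b, i < k_a, and those of
   Hom(V, W_1) q.  Put x = e^-1.  For each pair a, b, up to a monomial, the Pochhammer symbols
   (q x_b / x_a; q)_(k_b) (q x_a / x_b; q)_(k_a) and their counterparts in Eu_K(T)
   are both the product of the 1 - q^s x_a / x_b with - k_b <= s <= k_a, with the
   factor s = 0, respectively s = k_a - k_b, left out; the quotient of these two
   factors is the (a, b) factor of Delta(q^k x) / Delta(x). *)

Set Implicit Arguments.
Unset Strict Implicit.
Unset Printing Implicit Defensive.

Import GRing.Theory Num.Theory.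
Local Open Scope ring_scope.

(** * Multiplicities of weights *)

Section Characters.
Context {F : fieldType} {m : nat}.
Implicit Types (x : 'I_m -> F) (chi psi : char m).

Lemma char_eval0 x : char_eval x 0 = 1.
Proof. by apply: big1 => i _; rewrite ffunE expr0z. Qed.

Lemma char_evalD x chi psi : (forall i, x i != 0) ->
  char_eval x (chi + psi) = char_eval x chi * char_eval x psi.
Proof.
move=> x0; rewrite -big_split; apply: eq_bigr => i _.
by rewrite ffunE expfzDr.
Qed.

Lemma char_evalN x chi : char_eval x (- chi) = (char_eval x chi)^-1.
Proof.
rewrite -prodfV; apply: eq_bigr => i _.
by rewrite ffunE invr_expz.
Qed.

Lemma char_evalMn x chi k : (forall i, x i != 0) ->
  char_eval x (chi *+ k) = char_eval x chi ^+ k.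
Proof.
move=> x0; elim: k => [|k IH]; first by rewrite mulr0n expr0 char_eval0.
by rewrite mulrS char_evalD // IH exprS.
Qed.

Lemma char_eval_coord x i : char_eval x (coord_char i) = x i.
Proof.
rewrite /char_eval (bigD1 i) //= ffunE eqxx expr1z big1 ?mulr1 // => j ji.
by rewrite ffunE eq_sym (negbTE ji) expr0z.
Qed.

Lemma char_eval_neq0 x chi : (forall i, x i != 0) -> char_eval x chi != 0.
Proof. by move=> x0; apply/prodf_neq0 => i _; rewrite expfz_neq0. Qed.

End Characters.

(** [C] is only partially ordered, so the powers are compared in the rationals, through the
    embedding [ratr]. *)
Lemma two_expz_inj (C : numFieldType) (a b : int) :
  (2%:R : C) ^ a = 2%:R ^ b -> a = b.
Proof.
have -> : (2%:R : C) = ratr 2%:R by rewrite rmorph_nat.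
by rewrite -!fmorphXz => /fmorph_inj/ieexprIz; apply; rewrite ?ltr0n ?pnatr_eq1.
Qed.

Lemma char_separation (C : numFieldType) (m : nat) (chi psi : char m) :
  chi != psi -> exists2 t : 'I_m -> C,
    torus t & char_eval t chi != char_eval t psi.
Proof.
move=> ne; have [i nei] : exists i, chi i != psi i.
  apply/existsP; apply: contraNT ne; rewrite negb_exists => /forallP h.
  by apply/eqP/ffunP => i; apply/eqP; move: (h i); rewrite negbK.
(* With 2 at a coordinate where the characters differ and 1 elsewhere, the two values are
   [2 ^ chi i] and [2 ^ psi i]. *)
exists (fun j => if j == i then 2%:R else 1).
  by move=> j; case: ifP; rewrite ?oner_eq0 ?pnatr_eq0.
have ev phi : char_eval (fun j => if j == i then 2%:R else 1 : C) phi = 2%:R ^ phi i.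
  rewrite /char_eval (bigD1 i) //= eqxx big1 ?mulr1 // => j /negbTE ->.
  by rewrite exp1rz.
rewrite !ev; apply: contra nei => /eqP e; apply/eqP.
exact: two_expz_inj e.
Qed.

Section LinearPredicate.
Context {C : pzRingType} {U V : lmodType C} {f : U -> V} (f_lin : linear f).

Lemma zero_of_linear : f 0 = 0.
Proof. by have := f_lin (-1) 0 0; rewrite scaler0 addr0 scaleN1r addNr. Qed.

Lemma scalable_of_linear a u : f (a *: u) = a *: f u.
Proof. by have := f_lin a u 0; rewrite zero_of_linear !addr0. Qed.

Lemma linear_comb (K : finType) (c : K -> C) (v : K -> U) :
  f (\sum_k c k *: v k) = \sum_k c k *: f (v k).
Proof.
elim/big_ind2: _ => [|x1 x2 y1 y2 h1 h2|k _]; first exact: zero_of_linear.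
  by have := f_lin 1 x2 y2; rewrite !scale1r h1 h2.
exact: scalable_of_linear.
Qed.

End LinearPredicate.

Section WeightMultiplicity.
Context {C : numFieldType} {U : vectType C}.

Definition lin_indep (J : finType) (b : J -> U) : Prop :=
  forall c : J -> C, \sum_j c j *: b j = 0 -> forall j, c j = 0.

Lemma dim_sum_lines (J : finType) (b : J -> U) (A : pred J) :
  lin_indep b -> \dim (\sum_(j | A j) <[b j]>)%VS = #|A|.
Proof.
move=> bI.
have b0 j : b j != 0.
  apply/eqP => e; have := bI (fun l => (l == j)%:R).
  rewrite (bigD1 j) //= e scaler0 add0r big1 => [|l /negbTE ->]; last by rewrite scale0r.
  by move=> /(_ erefl j)/eqP; rewrite eqxx oner_eq0.
have /directvP /= -> : directv (\sum_(j | A j) <[b j]>)%VS.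
  apply/directv_sum_independent => us us_in us0 i Ai.
  have us_c j : exists c, A j -> us j = c *: b j.
    have [Aj|] := boolP (A j); last by exists 0.
    by have /vlineP [c ->] := us_in j Aj; exists c.
  have [c hc] := choice us_c.
  have ci : (if A i then c i else 0) = 0.
    apply: (bI (fun j => if A j then c j else 0)).
    apply: etrans us0; rewrite [RHS]big_mkcond; apply: eq_bigr => j _.
    by case: ifP => [/hc -> //|_]; rewrite scale0r.
  by rewrite hc //; move: ci; rewrite Ai => ->; rewrite scale0r.
by rewrite -sum1_card; apply: eq_bigr => j _; rewrite dim_vline b0.
Qed.

Lemma memv_sum_linesP (J : finType) (b : J -> U) (A : pred J) u :
  reflect (exists c : J -> C, u = \sum_(j | A j) c j *: b j)
    (u \in \sum_(j | A j) <[b j]>)%VS.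
Proof.
apply: (iffP memv_sumP) => [[us us_in ->]|[c ->]].
  have us_c j : exists c, A j -> us j = c *: b j.
    have [Aj|] := boolP (A j); last by exists 0.
    by have /vlineP [c ->] := us_in j Aj; exists c.
  have [c hc] := choice us_c; exists c.
  by apply: eq_bigr => j Aj; rewrite hc.
by exists (fun j => c j *: b j) => // j _; rewrite memvZ ?memv_line.
Qed.

(* Projecting along the other weight spaces replaces vectors of weight chi
   modulo S by vectors of weight chi, so the multiplicity is the codimension of
   the chi-weight space of S in that of U. *)
Lemma weight_mult_diag (m : nat) (S : set U) (act : ('I_m -> C) -> U -> U)
    (I J : finType) (b : J -> U) (wt : J -> char m) (s : I -> U)
    (wtS : I -> char m) (chi : char m) :
  (forall t, torus t -> linear (act t)) ->
  lin_indep b -> (forall u, exists c : J -> C, u = \sum_j c j *: b j) ->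
  (forall t j, torus t -> act t (b j) = char_eval t (wt j) *: b j) ->
  lin_indep s -> (forall u, S u <-> exists c : I -> C, u = \sum_i c i *: s i) ->
  (forall t i, torus t -> act t (s i) = char_eval t (wtS i) *: s i) ->
  (weight_mult S act chi)%:Z =
    \sum_j (wt j == chi)%:Z - \sum_i (wtS i == chi)%:Z.
Proof.
move=> act_lin bI bS b_wt sI SE s_wt.
have bI2 (c c' : J -> C) : \sum_j c j *: b j = \sum_j c' j *: b j -> c =1 c'.
  move=> e j; apply/eqP; rewrite -subr_eq0; apply/eqP.
  apply: (bI (fun j => c j - c' j)); under eq_bigr do rewrite scalerBl.
  by rewrite sumrB e subrr.
have [cf cfE] := choice bS.
(* Comparing [j]-th coordinates at a [t] that separates [wt j] from [psi] forces this coordinate to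
   vanish. *)
have cf_weight u psi : (forall t, torus t -> act t u = char_eval t psi *: u) ->
    forall j, wt j != psi -> cf u j = 0.
  move=> hu j /(char_separation C) [t tt ne].
  have := hu t tt; rewrite {1 2}(cfE u) linear_comb ?scaler_sumr; last exact: act_lin.
  under eq_bigr do rewrite b_wt // scalerA.
  under [RHS]eq_bigr do rewrite scalerA.
  move/bI2 => /(_ j) /eqP; rewrite mulrC -subr_eq0 -mulrBl mulf_eq0 subr_eq0.
  by rewrite (negbTE ne) => /eqP.
pose P psi u := \sum_(j | wt j == psi) cf u j *: b j.
have cfD a u v j : cf (a *: u + v) j = a * cf u j + cf v j.
  move: j; apply: bI2; rewrite -cfE {1}(cfE u) {1}(cfE v) scaler_sumr -big_split.
  by apply: eq_bigr => j _; rewrite scalerDl scalerA.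
have P_lin psi : linear (P psi).
  move=> a u v; rewrite /P scaler_sumr -big_split; apply: eq_bigr => j _.
  by rewrite cfD scalerDl scalerA.
have P_weight psi u : (forall t, torus t -> act t u = char_eval t psi *: u) ->
    forall phi, P phi u = if phi == psi then u else 0.
  move=> hu phi; case: eqVneq => [->|ne].
    rewrite {2}(cfE u) (bigID (fun j => wt j == psi)) /=.
    rewrite [X in _ = _ + X]big1 ?addr0 // => j ne.
    by rewrite (cf_weight u psi hu) // scale0r.
  by apply: big1 => j /eqP wj; rewrite (cf_weight u psi hu) ?scale0r // wj.
pose UW := (\sum_(j | wt j == chi) <[b j]>)%VS.
pose SW := (\sum_(i | wtS i == chi) <[s i]>)%VS.
have P_UW u : P chi u \in UW by apply/memv_sum_linesP; exists (cf u).
have UW_wt u : u \in UW -> forall t, torus t -> act t u = char_eval t chi *: u.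
  move=> /memv_sum_linesP [c ->] t tt; rewrite big_mkcond.
  have -> : \sum_i (if wt i == chi then c i *: b i else 0) =
      \sum_i (if wt i == chi then c i else 0) *: b i.
    by apply: eq_bigr => i _; case: ifP => //; rewrite scale0r.
  rewrite linear_comb ?scaler_sumr; last exact: act_lin.
  apply: eq_bigr => j _.
  case: ifP => [/eqP <-|_]; last by rewrite !scale0r scaler0.
  by rewrite b_wt // !scalerA mulrC.
have P_s psi i := P_weight (wtS i) (s i) (s_wt ^~ i) psi.
have SW_UW : (SW <= UW)%VS.
  apply/subvP => u /memv_sum_linesP [c ->]; apply: memv_suml => i /eqP wi.
  by apply: memvZ; have := P_UW (s i); rewrite P_s wi eqxx.
(* [S] is spanned by the weight vectors [s i], each of which a projection either keeps or kills. *)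
have P_S psi u : S u -> S (P psi u).
  move=> /SE [c ->]; rewrite (linear_comb (P_lin psi)); apply/SE.
  exists (fun i => if psi == wtS i then c i else 0).
  by apply: eq_bigr => i _; rewrite P_s; case: ifP => //; rewrite scaler0 scale0r.
have S_UW u : S u -> u \in UW -> u \in SW.
  move=> /SE [c uE] uU; have := P_weight chi u (UW_wt u uU) chi.
  rewrite eqxx uE (linear_comb (P_lin chi)) => <-; apply: memv_suml => i _.
  rewrite P_s; case: ifP => [/eqP wi|_]; last by rewrite scaler0 mem0v.
  by rewrite memvZ // (subvP (sumv_sup i _ (subvv _))) ?memv_line ?wi.
have SW_S u : u \in SW -> S u.
  move=> /memv_sum_linesP [c ->]; apply/SE.
  exists (fun i => if wtS i == chi then c i else 0); rewrite big_mkcond.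
  by apply: eq_bigr => i _; case: ifP => //; rewrite scale0r.
have S_lin a u v : S u -> S v -> S (a *: u + v).
  move=> /SE [c ->] /SE [c' ->]; apply/SE; exists (fun i => a * c i + c' i).
  rewrite scaler_sumr -big_split; apply: eq_bigr => i _.
  by rewrite scalerDl scalerA.
have S0 : S 0 by apply/SE; exists (fun=> 0); rewrite big1 // => i _; rewrite scale0r.
have SZ a u : S u -> S (a *: u) by move=> Su; rewrite -[_ *: _]addr0; apply: S_lin.
have SD u v : S u -> S v -> S (u + v) by move=> Su Sv; rewrite -[u]scale1r; apply: S_lin.
have P_act psi t u : torus t -> P psi (act t u) = char_eval t psi *: P psi u.
  move=> tt.
  have -> : P psi u = \sum_j (if wt j == psi then cf u j *: b j else 0).
    by rewrite /P big_mkcond.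
  rewrite {1}(cfE u) (linear_comb (act_lin t tt)) (linear_comb (P_lin psi)) scaler_sumr; apply: eq_bigr => j _.
  rewrite b_wt // (scalable_of_linear (P_lin psi)) (P_weight (wt j) (b j) (fun t => b_wt t j)) eq_sym.
  by case: ifP => [/eqP ->|_]; rewrite ?scaler0 // !scalerA mulrC.
(* For [psi != chi], projecting the element [act t u - chi(t) u] of [S] gives
   [(psi(t) - chi(t)) P psi u], and at a separating [t] the scalar is invertible. So [u] agrees
   modulo [S] with its [chi]-component. *)
have S_weight u : weight_mod S act chi u -> S (u - P chi u).
  move=> hu.
  have S_P psi : psi != chi -> S (P psi u).
    move=> /(char_separation C) [t tt ne].
    have := P_S psi _ (hu t tt); rewrite addrC -scaleNr P_lin P_act //.
    rewrite scaleNr addrC -scalerBl => /(SZ (char_eval t psi - char_eval t chi)^-1).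
    by rewrite scalerA mulVf ?scale1r // subr_eq0.
  rewrite {1}(cfE u) /P [X in X - _](bigID (fun j => wt j == chi)) /= addrAC subrr add0r.
  (* The remaining terms are grouped by weight over the finite image of [wt]; each group is one
     [P psi u]. *)
  rewrite (partition_big (fun j => SeqSub (codom_f wt j)) predT) //=.
  apply: (big_ind S S0 SD) => psi _; case: (eqVneq (val psi) chi) => [e|ne].
    rewrite big1 // => j /andP[/negbTE wj /eqP/(congr1 val)/= wpsi].
    by rewrite wpsi e eqxx in wj.
  have := S_P _ ne; congr (S _); apply: eq_bigl => j.
  rewrite -val_eqE /=; case: (eqVneq (wt j) (val psi)) => [->|]; last by rewrite andbF.
  by rewrite ne.
(* Projection changes weight vectors modulo [S] only by elements of [S], so independence modulo [S]
   survives it; the span of the projections lies in [UW] and meets [SW] trivially. *)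
have mult_le : (weight_mult S act chi <= \dim UW - \dim SW)%N.
  apply/bigmax_leqP => k /asboolP [u [uI uw]].
  pose v i := P chi (u i).
  have hv c : S (\sum_i c i *: v i) -> forall i, c i = 0.
    move=> Sc; apply: uI.
    have -> : \sum_i c i *: u i =
        \sum_i c i *: (u i - v i) + \sum_i c i *: v i.
      by rewrite -big_split; apply: eq_bigr => i _; rewrite /= -scalerDr subrK.
    apply: (SD _ _ _ Sc); apply: (big_ind S S0 SD) => i _.
    by apply/SZ/S_weight/uw.
  have vI : lin_indep v by move=> c c0; apply: hv; rewrite c0.
  have vS : (SW :&: (\sum_i <[v i]>) = 0)%VS.
    apply/eqP; rewrite -subv0; apply/subvP => w /memv_capP [/SW_S Sw].
    move=> /memv_sum_linesP [c wE]; rewrite wE in Sw *.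
    by rewrite big1 ?mem0v // => i _; rewrite (hv c) // scale0r.
  have dv : \dim (\sum_i <[v i]>)%VS = k by rewrite dim_sum_lines // card_ord.
  rewrite leq_subRL ?dimvS // -dv -dimv_disjoint_sum // dimvS // subv_add SW_UW.
  by apply/subv_sumP => i _; rewrite -memvE P_UW.
(* A basis of a complement of [SW] in [UW] attains the bound, because [S] meets [UW] only in
   [SW]. *)
have mult_ge : (\dim UW - \dim SW <= weight_mult S act chi)%N.
  have dE : (\dim UW - \dim SW = \dim (UW :\: SW))%N.
    by rewrite -(dimv_cap_compl UW SW) (capv_idPr SW_UW) addKn.
  rewrite dE.
  have lt : (\dim (UW :\: SW) < (dim U).+1)%N by rewrite ltnS -dimvf dimvS ?subvf.
  apply: (bigmax_sup (Ordinal lt)) => //=; apply/asboolP.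
  pose X := vbasis (UW :\: SW)%VS.
  have XD (i : 'I_(\dim (UW :\: SW))) : X`_i \in (UW :\: SW)%VS.
    by apply: vbasis_mem; rewrite mem_nth // size_tuple.
  exists (fun i => X`_i); split => [c Sc i|i t tt].
    have /freeP := basis_free (vbasisP (UW :\: SW)%VS); apply.
    have : \sum_i c i *: X`_i \in ((UW :\: SW) :&: SW)%VS.
      apply/memv_capP; split; first by apply: memv_suml => l _; rewrite memvZ ?XD.
      apply: S_UW => //; apply: memv_suml => l _.
      by rewrite memvZ // (subvP (diffvSl UW SW)) ?XD.
    by rewrite capv_diff memv0 => /eqP.
  by rewrite UW_wt ?subrr // (subvP (diffvSl UW SW)) ?XD.
have -> : weight_mult S act chi = (\dim UW - \dim SW)%N.
  by apply/eqP; rewrite eqn_leq mult_le.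
have cardz (K : finType) (p : pred K) : #|p|%:Z = \sum_j (p j)%:Z.
  rewrite -sum1_card big_mkcond -[LHS]intz sumMz; apply: eq_bigr => j _.
  by rewrite intz -topredE /=; case: (p j).
by rewrite -subzn ?dimvS // /UW /SW !dim_sum_lines // !cardz.
Qed.

End WeightMultiplicity.

(** * Characters at a torus-fixed point *)

Section Triples.
Context {C : numClosedFieldType} {r0 r1 n : nat}.
Let r := (r0 + r1)%N.
Let V : vectType C := triple C r0 r1 n.
Implicit Types (X Y : triple C r0 r1 n) (g h : 'M[C]_n) (t : 'I_(tdim r) -> C).

(** Unlike [torus_act], this family of actions is closed under transposition, which merely swaps [x]
    and [y]; one normal form can therefore serve both stability conditions. *)
Definition scale_act (a : C) (x : 'I_r0 -> C) (y : 'I_r1 -> C) X :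
    triple C r0 r1 n :=
  (a *: X.1.1, X.1.2 *m diag_mx (\row_i x i), diag_mx (\row_i y i) *m X.2).

Lemma torus_actE t X :
  torus_act t X =
  scale_act (t (iq r)) (fun a => (t (ie (lshift r1 a)))^-1)
    (fun b => t (iq r) * t (ie (rshift r0 b))) X.
Proof.
congr (_, _); rewrite /torus_act /= scalemxAl; congr (_ *m _).
by apply/matrixP => i j; rewrite !mxE mulrnAr.
Qed.

Lemma gl_act_lin h : linear (@gl_act C r0 r1 n h : V -> V).
Proof.
move=> a [[B z] w] [[B' z'] w']; rewrite /gl_act /=; congr (_, _, _) => /=.
- by rewrite mulmxDr mulmxDl -scalemxAr -scalemxAl.
- by rewrite mulmxDr -scalemxAr.
- by rewrite mulmxDl -scalemxAl.
Qed.

Lemma gl_actM g h X : g \in unitmx -> h \in unitmx ->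
  gl_act g (gl_act h X) = gl_act (g *m h) X.
Proof.
move=> ug uh; have e : invmx (g *m h) = invmx h *m invmx g.
  have ugh : g *m h \in unitmx by rewrite unitmx_mul ug.
  apply: (can_inj (mulKmx ugh)).
  by rewrite mulmxV // mulmxA -(mulmxA g) mulmxV // mulmx1 mulmxV.
by rewrite /gl_act /= e !mulmxA.
Qed.

Lemma gl_act1 X : gl_act 1%:M X = X.
Proof.
case: X => [[B z] w]; rewrite /gl_act /=.
have -> : invmx (1%:M : 'M[C]_n) = 1%:M.
  by have := mulVmx (unitmx1 C n); rewrite mulmx1.
by rewrite !mul1mx !mulmx1.
Qed.

Lemma gl_actK h : h \in unitmx ->
  cancel (@gl_act C r0 r1 n h) (gl_act (invmx h)).
Proof. by move=> uh X; rewrite gl_actM ?unitmx_inv // mulVmx // gl_act1. Qed.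

Lemma gl_actVK h : h \in unitmx ->
  cancel (gl_act (invmx h)) (@gl_act C r0 r1 n h).
Proof. by move=> uh X; rewrite gl_actM ?unitmx_inv // mulmxV // gl_act1. Qed.

Lemma torus_act_lin t : linear (@torus_act C r0 r1 n t : V -> V).
Proof.
move=> a [[B z] w] [[B' z'] w']; rewrite /torus_act /=; congr (_, _, _) => /=.
- by rewrite scalerDr !scalerA mulrC.
- by rewrite mulmxDl -scalemxAl.
- by rewrite mulmxDr scalerDr -scalemxAr !scalerA mulrC.
Qed.

Lemma torus_act_gl t h X : torus_act t (gl_act h X) = gl_act h (torus_act t X).
Proof.
rewrite /torus_act /gl_act /=; congr (_, _, _).
- by rewrite -scalemxAr -scalemxAl.
- by rewrite mulmxA.
- by rewrite -scalemxAl mulmxA.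
Qed.

Lemma invmx_diag (c : 'I_n -> C) : (forall j, c j != 0) ->
  invmx (diag_mx (\row_j c j)) = diag_mx (\row_j (c j)^-1).
Proof.
move=> c0; have e : diag_mx (\row_j c j) *m diag_mx (\row_j (c j)^-1) = 1%:M.
  by rewrite mulmx_diag; apply/matrixP => i j; rewrite !mxE mulfV.
by have [u _] := mulmx1_unit e; rewrite -[LHS]mulmx1 -e mulKmx.
Qed.

Lemma gl_act_diag (c : 'I_n -> C) X : (forall j, c j != 0) ->
  gl_act (diag_mx (\row_j c j)) X =
  (\matrix_(i, j) (c i * X.1.1 i j / c j), \matrix_(i, j) (c i * X.1.2 i j),
   \matrix_(i, j) (X.2 i j / c j)).
Proof.
move=> c0; rewrite /gl_act invmx_diag //; congr (_, _, _).
- by rewrite mul_mx_diag mul_diag_mx; apply/matrixP => i j; rewrite !mxE.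
- by rewrite mul_diag_mx; apply/matrixP => i j; rewrite !mxE.
- by rewrite mul_mx_diag; apply/matrixP => i j; rewrite !mxE.
Qed.

Definition gl_tangent_map X (xi : 'M[C]_n) : triple C r0 r1 n :=
  (xi *m X.1.1 - X.1.1 *m xi, xi *m X.1.2, - (X.2 *m xi)).

Lemma gl_tangent_map_lin X : linear (gl_tangent_map X : 'M[C]_n -> V).
Proof.
move=> a xi xi'; rewrite /gl_tangent_map; congr (_, _, _) => /=.
- by rewrite mulmxDl mulmxDr -scalemxAl -scalemxAr opprD addrACA -scalerBr.
- by rewrite mulmxDl -scalemxAl.
- by rewrite mulmxDr opprD -scalemxAr scalerN.
Qed.

Lemma torus_act_tangent t X xi :
  torus_act t (gl_tangent_map X xi) = gl_tangent_map (torus_act t X) xi.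
Proof.
rewrite /torus_act /gl_tangent_map /=; congr (_, _, _).
- by rewrite scalerBr -scalemxAl -scalemxAr.
- by rewrite mulmxA.
- by rewrite mulmxN scalerN -scalemxAl mulmxA.
Qed.

Lemma gl_act_tangent g X xi : g \in unitmx ->
  gl_act g (gl_tangent_map X xi) =
  gl_tangent_map (gl_act g X) (g *m xi *m invmx g).
Proof.
move=> ug; rewrite /gl_act /gl_tangent_map /= !mulmxA !mulmxKV //.
by rewrite mulmxBr mulmxBl mulNmx !mulmxA.
Qed.

(* Rigidity makes both the stabilizer in GL(V) and its Lie algebra trivial. *)
Definition rigid X : Prop :=
  forall (a : C) (xi : 'M[C]_n), a != 0 ->
  a *: (xi *m X.1.1) = X.1.1 *m xi -> xi *m X.1.2 = 0 -> X.2 *m xi = 0 -> xi = 0.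

Definition diag_char (d : 'I_n -> char (tdim r)) t : 'M[C]_n :=
  diag_mx (\row_j char_eval t (d j)).

(** For rigid [X] the matrix [diag_char d t] is the lift of [t], so the [d j] are the weights of the
    tautological fibre in the standard basis. *)
Definition diag_fixed (d : 'I_n -> char (tdim r)) X : Prop :=
  forall t, torus t -> gl_act (diag_char d t) (torus_act t X) = X.

Lemma diag_char_unit (d : 'I_n -> char (tdim r)) t :
  torus t -> diag_char d t \in unitmx.
Proof.
move=> tt; rewrite unitmxE det_diag unitfE; apply/prodf_neq0 => i _.
by rewrite mxE char_eval_neq0.
Qed.

(** Two lifts satisfy the same linear equations, so their difference satisfies the homogeneous ones
    in [rigid], with [a] the value of [q] at [t]. *)
Lemma fix_lift_uniq X t g : torus t -> rigid X ->
  g \in unitmx -> gl_act g (torus_act t X) = X -> fix_lift X t = g.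
Proof.
move=> tt rX ug gX; rewrite /fix_lift.
have [] := @xgetPex _ 1%:M [set g | g \in unitmx /\ gl_act g (torus_act t X) = X].
  by exists g.
set g' := xget _ _ => ug' gX'.
have q0 : t (iq r) != 0 by exact: tt.
have main f : f \in unitmx -> gl_act f (torus_act t X) = X ->
    [/\ t (iq r) *: (f *m X.1.1) = X.1.1 *m f,
        f *m X.1.2 = X.1.2 *m diag_mx (\row_(a < r0) t (ie (lshift r1 a))) &
        X.2 *m f = (torus_act t X).2].
  move=> uf fX; split.
  - by rewrite -{2}fX /= mulmxKV // -scalemxAr.
  - rewrite -{2}fX /= -!mulmxA mulmx_diag.
    rewrite -[LHS]mulmx1 -mulmxA; congr (_ *m (_ *m _)).
    apply/matrixP => i j; rewrite !mxE mulVf //; exact: tt.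
  - by rewrite -{1}fX /= mulmxKV.
have [h1 h2 h3] := main g ug gX; have [h1' h2' h3'] := main g' ug' gX'.
apply/eqP; rewrite -subr_eq0; apply/eqP/(rX (t (iq r))) => //.
- by rewrite mulmxBl mulmxBr scalerBr h1 h1'.
- by rewrite mulmxBl h2 h2' subrr.
- by rewrite mulmxBr h3 h3' subrr.
Qed.

End Triples.

Section Classes.
Context {C : numClosedFieldType} {r0 r1 n : nat}.
Let r := (r0 + r1)%N.
Let V : vectType C := triple C r0 r1 n.
Context (X0 : triple C r0 r1 n) (h : 'M[C]_n) (d : 'I_n -> char (tdim r)).
Let X := gl_act h X0.
Hypotheses (uh : h \in unitmx) (rX : rigid X) (dX : diag_fixed d X0).

Lemma fix_lift_diag t : torus t ->
  fix_lift X t = h *m diag_char d t *m invmx h.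
Proof.
move=> tt; have uD := diag_char_unit d tt.
apply: fix_lift_uniq => //; first by rewrite !unitmx_mul uh uD unitmx_inv.
rewrite torus_act_gl gl_actM // ?unitmx_mul ?uh ?uD ?unitmx_inv //.
by rewrite mulmxKV // -gl_actM // dX.
Qed.

Lemma taut_class_diag chi : taut_class X chi = \sum_j (d j == chi)%:Z.
Proof.
have fl t (v : 'cV[C]_n) : torus t ->
    fix_lift X t *m (h *m v) = h *m (diag_char d t *m v).
  by move=> tt; rewrite fix_lift_diag // !mulmxA mulmxKV.
rewrite -[RHS]subr0.
(* The zero subspace is spanned by the empty family; the columns of [h] are the weight basis. *)
rewrite /taut_class /rep_class (weight_mult_diag (I := 'I_0) (J := 'I_n)
  (b := fun j => h *m delta_mx j 0) (wt := d) (s := fun=> 0) (wtS := fun=> 0)).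
- by rewrite big_ord0.
- by move=> t tt a u v; rewrite mulmxDr -scalemxAr.
- move=> c c0 j; have : h *m (\sum_j c j *: delta_mx j 0) = 0 :> 'cV[C]_n.
    by rewrite mulmx_sumr -[RHS]c0; apply: eq_bigr => l _; rewrite scalemxAr.
  move/(congr1 (mulmx (invmx h))); rewrite mulKmx // mulmx0 => /matrixP/(_ j 0).
  rewrite summxE (bigD1 j) //= !mxE !eqxx mulr1 big1 ?addr0 // => l lj.
  by rewrite !mxE eq_sym (negbTE lj) mulr0.
- move=> u; exists (fun j => (invmx h *m u) j 0).
  transitivity (h *m (\sum_j (invmx h *m u) j 0 *: (delta_mx j 0 : 'cV[C]_n))).
    have -> : \sum_j (invmx h *m u) j 0 *: (delta_mx j 0 : 'cV[C]_n) = invmx h *m u.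
      rewrite [RHS]matrix_sum_delta; apply: eq_bigr => j _.
      by rewrite big_ord1.
    by rewrite mulKVmx.
  by rewrite mulmx_sumr; apply: eq_bigr => l _; rewrite scalemxAr.
- move=> t j tt; rewrite fl // scalemxAr; congr (_ *m _).
  rewrite mul_diag_mx; apply/matrixP => i l; rewrite !mxE.
  by case: eqP => [->|_]; rewrite ?mulr0.
- by move=> c _ [].
- move=> u; split => [->|[c ->]]; last by rewrite big_ord0.
  by exists (fun=> 0); rewrite big_ord0.
- by move=> t [].
Qed.

Definition tangent_index : finType :=
  (('I_n * 'I_n) + ('I_n * 'I_r0) + ('I_r1 * 'I_n))%type.

Definition tangent_basis (j : tangent_index) : V :=
  match j with
  | inl (inl p) => (delta_mx p.1 p.2, 0, 0)
  | inl (inr p) => (0, delta_mx p.1 p.2, 0)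
  | inr p => (0, 0, delta_mx p.1 p.2)
  end.

Definition tangent_weight (j : tangent_index) : char (tdim r) :=
  match j with
  | inl (inl p) => coord_char (iq r) + (d p.1 - d p.2)
  | inl (inr p) => d p.1 - coord_char (ie (lshift r1 p.2))
  | inr p => coord_char (iq r) + coord_char (ie (rshift r0 p.1)) - d p.2
  end.

Definition tangent_coord (Y : triple C r0 r1 n) (j : tangent_index) : C :=
  match j with
  | inl (inl p) => Y.1.1 p.1 p.2
  | inl (inr p) => Y.1.2 p.1 p.2
  | inr p => Y.2 p.1 p.2
  end.

Lemma tangent_coord_lin j : linear (tangent_coord^~ j : V -> C^o).
Proof. by move=> a [[B z] w] [[B' z'] w']; case: j => [[]|] p; rewrite /= !mxE. Qed.

Lemma tangent_coord_basis (c : tangent_index -> C) :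
  tangent_coord (\sum_j c j *: tangent_basis j) =1 c.
Proof.
move=> l; have tc_sum : tangent_coord (\sum_j c j *: tangent_basis j) l =
    \sum_j c j * tangent_coord (tangent_basis j) l.
  elim/big_ind2: _ => [|x1 x2 y1 y2 h1 h2|j _].
  - by case: l => [[]|] p; rewrite /= mxE.
  - by rewrite -h1 -h2; have := tangent_coord_lin l 1 x2 y2; rewrite !scale1r.
  - have -> : tangent_coord (c j *: tangent_basis j) l =
        tangent_coord (c j *: tangent_basis j + 0) l by rewrite addr0.
    rewrite tangent_coord_lin.
    have -> : tangent_coord 0 l = 0 by case: (l) => [[]|] p; rewrite /= mxE.
    by rewrite addr0.
have tcb j : tangent_coord (tangent_basis j) l = (j == l)%:R.
  case: j l {tc_sum} => [[]|] [i j] [[]|] [i' j'] /=; rewrite mxE //;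
    by congr ((nat_of_bool _)%:R); apply/andP/eqP => [[/eqP -> /eqP ->] //|[-> ->]].
rewrite tc_sum (bigD1 l) //= tcb eqxx mulr1 big1 ?addr0 // => j /negbTE jl.
by rewrite tcb jl mulr0.
Qed.

Lemma tangent_coord_inj Y Y' : tangent_coord Y =1 tangent_coord Y' -> Y = Y'.
Proof.
case: Y Y' => [[B z] w] [[B' z'] w'] e; congr (_, _, _); apply/matrixP => i j.
- exact: (e (inl (inl (i, j)))).
- exact: (e (inl (inr (i, j)))).
- exact: (e (inr (i, j))).
Qed.

Lemma tangent_basisE Y : Y = \sum_j tangent_coord Y j *: tangent_basis j.
Proof. by apply: tangent_coord_inj => j; rewrite tangent_coord_basis. Qed.

Lemma tangent_basis_weight t j : torus t ->
  gl_act (diag_char d t) (torus_act t (tangent_basis j)) =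
  char_eval t (tangent_weight j) *: tangent_basis j.
Proof.
move=> tt; rewrite gl_act_diag; last by move=> l; rewrite char_eval_neq0.
have delta_eq (a b : C) (s s' : nat) (p : 'I_s * 'I_s') i l :
    (i = p.1 -> l = p.2 -> a = b) ->
    a * (delta_mx p.1 p.2 : 'M[C]_(s, s')) i l = b * delta_mx p.1 p.2 i l.
  rewrite mxE; case: eqP => [->|_]; last by rewrite !mulr0.
  by case: eqP => [->|_] ab; rewrite ?mulr0 // ab.
have t0 i : t i != 0 by exact: tt.
have c0 i : char_eval t (d i) != 0 by exact: char_eval_neq0.
apply: tangent_coord_inj.
case: j => [[]|] p [[]|] [i l] /=;
  try by rewrite ?mul_mx_diag ?mul_diag_mx !mxE ?(mulr0, mul0r).
- rewrite mxE [RHS]mxE; have := delta_eq _ _ _ _ p i l; move: (delta_mx _ _) => D.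
  rewrite mxE => e; rewrite mulrA mulrAC; apply: e => -> ->.
  by rewrite !char_evalD // char_evalN char_eval_coord mulrA (mulrC (t _)).
- rewrite mul_mx_diag mxE [RHS]mxE; have := delta_eq _ _ _ _ p i l.
  move: (delta_mx _ _) => D; rewrite !mxE => e.
  rewrite mulrA mulrAC; apply: e => -> ->.
  by rewrite !char_evalD // char_evalN char_eval_coord.
- rewrite mul_diag_mx mxE [RHS]mxE; have := delta_eq _ _ _ _ p i l.
  move: (delta_mx _ _) => D; rewrite !mxE => e.
  rewrite mulrA mulrAC; apply: e => -> ->.
  by rewrite !char_evalD // char_evalN !char_eval_coord.
Qed.

(** By rigidity with [a = 1], [gl_tangent_map] is injective; being equivariant, it makes the
    subspace divided out a copy of End(V), with weights [d i - d j]. All bases are transported from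
    [X0] to [X] by [h]. *)
Lemma tangent_class_diag chi :
  tangent_class X chi =
  \sum_j (tangent_weight j == chi)%:Z - \sum_i \sum_j (d i - d j == chi)%:Z.
Proof.
have act_h t Y : torus t ->
    gl_act (fix_lift X t) (torus_act t (gl_act h Y)) =
    gl_act h (gl_act (diag_char d t) (torus_act t Y)).
  move=> tt; have uD := diag_char_unit d tt.
  rewrite fix_lift_diag // torus_act_gl !gl_actM //
    ?unitmx_mul ?uh ?uD ?unitmx_inv //.
  by rewrite mulmxKV.
pose s (p : 'I_n * 'I_n) : V := gl_act h (gl_tangent_map X0 (delta_mx p.1 p.2)).
have sE (c : 'I_n * 'I_n -> C) : \sum_p c p *: s p =
    gl_tangent_map X (h *m (\matrix_(i, j) c (i, j)) *m invmx h).
  rewrite -gl_act_tangent // [X in gl_tangent_map _ X]matrix_sum_delta.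
  rewrite pair_big /= (linear_comb (gl_tangent_map_lin X0)).
  rewrite (linear_comb (gl_act_lin h)).
  by apply: eq_bigr => -[i j] _; rewrite mxE.
rewrite pair_big.
apply: (weight_mult_diag (b := fun j => gl_act h (tangent_basis j) : V) (s := s)
  (wt := tangent_weight) (wtS := fun p => d p.1 - d p.2)).
- move=> t tt a Y Y'; by rewrite torus_act_lin gl_act_lin.
- move=> c; rewrite -(linear_comb (gl_act_lin h)).
  move/(congr1 (gl_act (invmx h))); rewrite gl_actK // => c0 j.
  rewrite -[c j]tangent_coord_basis c0.
  have -> : gl_act (invmx h) (0 : V) = 0 :> V.
    exact: zero_of_linear (gl_act_lin _).
  by case: j => [[]|] p; rewrite /= mxE.
- move=> u; exists (tangent_coord (gl_act (invmx h) u)).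
  rewrite -(linear_comb (gl_act_lin h)) -tangent_basisE.
  by rewrite gl_actVK.
- move=> t j tt; rewrite act_h // tangent_basis_weight //.
  by rewrite (scalable_of_linear (gl_act_lin h)).
- move=> c; rewrite sE => c0 [i j].
  have c1 : h *m (\matrix_(i, j) c (i, j)) *m invmx h = 0.
    move: c0 => [e1 e2 e3]; apply: (rX (oner_neq0 _)) => //.
      by rewrite scale1r; apply/eqP; rewrite -subr_eq0 e1.
    by rewrite -[LHS]opprK e3 oppr0.
  have : \matrix_(i, j) c (i, j) = 0.
    move: c1 => /(congr1 (fun M => invmx h *m M *m h)).
    by rewrite !mulmxA mulVmx // mul1mx mulmxKV // mulmx0 mul0mx.
  by move=> /matrixP/(_ i j); rewrite !mxE.
- move=> u; split => [[xi ->]|[c ->]]; last by eexists; exact: sE.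
  exists (fun p => (invmx h *m xi *m h) p.1 p.2); rewrite sE.
  congr (gl_tangent_map _ _).
  rewrite (_ : \matrix_(_, _) _ = invmx h *m xi *m h).
    by rewrite !mulmxA mulmxV // mul1mx mulmxK.
  by apply/matrixP => i j; rewrite mxE.
- move=> t [i j] tt; rewrite /s act_h // torus_act_tangent.
  have uD := diag_char_unit d tt.
  rewrite gl_act_tangent // dX //=.
  have -> : diag_char d t *m delta_mx i j *m invmx (diag_char d t) =
     char_eval t (d i - d j) *: delta_mx i j.
    have := @gl_act_diag C r0 r1 n (fun j => char_eval t (d j)) (delta_mx i j, 0, 0).
    move=> /(_ (fun l => char_eval_neq0 (d l) tt)).
    move=> /(congr1 (fun Y : triple C r0 r1 n => Y.1.1)) /= ->.
    apply/matrixP => k l; rewrite !mxE char_evalD // char_evalN.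
    case: eqP => [->|_]; last by rewrite !(mulr0, mul0r).
    case: eqP => [->|_]; last by rewrite !(mulr0, mul0r).
    by rewrite !mulr1.
  rewrite (scalable_of_linear (gl_tangent_map_lin X0)).
  by rewrite (scalable_of_linear (gl_act_lin h)).
Qed.

End Classes.

(** * Stability and duality *)

Section Krylov.
Context {C : numClosedFieldType}.

(* Classically, every linearly closed set of vectors is a subspace: take a
   subspace of maximal dimension among those it contains. *)
Lemma vspace_of_linear_set {U : vectType C} (S : U -> Prop) :
  S 0 -> (forall a u v, S u -> S v -> S (a *: u + v)) ->
  exists W : {vspace U}, forall u, u \in W <-> S u.
Proof.
move=> S0 S_lin.
pose inS k := `[< exists W : {vspace U}, \dim W = k /\ forall u, u \in W -> S u >].
have ex : exists k, inS k.
  exists 0%N; apply/asboolP; exists 0%VS; split; first exact: dimv0.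
  by move=> u; rewrite memv0 => /eqP ->.
have ub k : inS k -> (k <= dim U)%N.
  by move=> /asboolP [W [<- _]]; rewrite -dimvf dimvS ?subvf.
case: (ex_maxnP ex ub) => k /asboolP [W [Wk WS]] kmax.
exists W => u; split; first exact: WS.
move=> Su; apply/negPn/negP => uW.
have /kmax : inS (\dim (W + <[u]>)%VS).
  apply/asboolP; exists (W + <[u]>)%VS; split=> // v /memv_addP [w wW [w' ]].
  by move=> /vlineP [a ->] ->; rewrite addrC; apply: S_lin (WS _ wW).
rewrite leqNgt -Wk => /negP; apply; rewrite ltn_neqAle dimvS ?addvSl // andbT.
apply: contra uW => /eqP e.
have := dimv_leqif_eq (addvSl W <[u]>%VS) => /leqifP.
case: eqP => [-> _|_]; last by rewrite e ltnn.
exact: (subvP (addvSr W <[u]>%VS) _ (memv_line u)).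
Qed.

(** Induction on the size of a set containing the support of the relation: [g - lam i] removes the
    [i]-th term and multiplies the others by nonzero scalars. *)
Lemma eigen_lin_indep (n : nat) (J : finType) (g : 'M[C]_n) (lam : J -> C)
    (v : J -> 'cV[C]_n) :
  injective lam -> (forall j, g *m v j = lam j *: v j) ->
  (forall j, v j != 0) -> lin_indep v.
Proof.
move=> lam_inj gv v0 c c0.
have main k (D : {set J}) (b : J -> C) : #|D| = k ->
    (forall j, j \notin D -> b j = 0) -> \sum_j b j *: v j = 0 ->
    forall j, b j = 0.
  elim: k D b => [|k IH] D b Dk bD b0 j.
    by apply: bD; move/eqP: Dk; rewrite cards_eq0 => /eqP ->; rewrite inE.
  have [i iD] : exists i, i \in D by apply/card_gt0P; rewrite Dk.
  have bi l : l != i -> b l = 0.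
    move=> li; have := IH (D :\ i) (fun l => b l * (lam l - lam i)).
    have -> : #|D :\ i| = k by move: Dk; rewrite (cardsD1 i) iD => -[].
    move=> /(_ erefl) h; apply/eqP.
    suff /eqP : b l * (lam l - lam i) = 0.
      by rewrite mulf_eq0 subr_eq0 => /orP[//|/eqP/lam_inj e]; rewrite e eqxx in li.
    apply: h => [j'|].
      rewrite !inE negb_and negbK => /orP[/eqP ->|/bD ->]; last by rewrite mul0r.
      by rewrite subrr mulr0.
    transitivity (g *m (\sum_j b j *: v j) - lam i *: (\sum_j b j *: v j)).
      rewrite mulmx_sumr scaler_sumr -sumrB; apply: eq_bigr => j' _.
      by rewrite -scalemxAr gv !scalerA -scalerBl mulrBr (mulrC (lam i)).
    by rewrite b0 mulmx0 scaler0 subrr.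
  have [->|/bi //] := eqVneq j i.
  move: b0; rewrite (bigD1 i) //= big1 => [|l /bi ->]; last by rewrite scale0r.
  by move=> /eqP; rewrite addr0 scaler_eq0 (negbTE (v0 i)) orbF => /eqP.
by apply: (main _ [set: J] c erefl) => // j; rewrite inE.
Qed.

Context {r0 r1 n : nat}.
Implicit Types (X : triple C r0 r1 n) (h : 'M[C]_n).

Definition krylov X (i : nat) : 'M[C]_(n, r0) := iter i (mulmx X.1.1) X.1.2.

Lemma krylov_gl h X i : h \in unitmx ->
  krylov (gl_act h X) i = h *m krylov X i.
Proof.
move=> uh; elim: i => [//|i IH].
by rewrite /krylov !iterS -!/(krylov _ _) IH /= mulmxA mulmxKV // mulmxA.
Qed.

(* The rows annihilating all B^i z form the annihilator of the smallest
   B-stable subspace containing im z. *)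
Definition generating X : Prop :=
  forall y : 'rV[C]_n, (forall i, y *m krylov X i = 0) -> y = 0.

Lemma generating_gl h X : h \in unitmx -> generating X -> generating (gl_act h X).
Proof.
move=> uh gX y hy; have : y *m h = 0.
  by apply: gX => i; rewrite -mulmxA -krylov_gl.
by move/(congr1 (mulmx^~ (invmx h))); rewrite mulmxK // mul0mx.
Qed.

(** The commutation relation propagates [xi z = 0] to [xi B^i z = 0] for all [i], so every row of
    [xi] annihilates the Krylov matrices. *)
Lemma generating_rigid X : generating X -> rigid X.
Proof.
move=> gX a xi a0 xiB xiz _.
have xiK i : xi *m krylov X i = 0.
  elim: i => [//|i IH]; apply: (scalerI a0); rewrite scaler0.
  by rewrite /krylov iterS mulmxA scalemxAl xiB -mulmxA -/(krylov _ _) IH mulmx0.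
apply/row_matrixP => j; rewrite row0; apply: gX => i.
by rewrite -row_mul xiK row0.
Qed.

(** The [v] with [y B^i v = 0] for all [i] form a [B]-stable subspace containing the image of [z],
    hence all of [V]; then [i = 0] gives [y = 0]. *)
Lemma stable_minus_generating X : stable_minus X -> generating X.
Proof.
move=> sX y hy.
have [| |U hU] := @vspace_of_linear_set 'cV[C]_n
  (fun v => forall i, y *m iter i (mulmx X.1.1) v = 0).
- move=> i; suff -> : iter i (mulmx X.1.1) (0 : 'cV_n) = 0 by rewrite mulmx0.
  by elim: i => //= i ->; rewrite mulmx0.
- move=> a u v hu hv i.
  have -> : iter i (mulmx X.1.1) (a *: u + v) =
      a *: iter i (mulmx X.1.1) u + iter i (mulmx X.1.1) v.
    by elim: i => //= i ->; rewrite mulmxDr -scalemxAr.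
  by rewrite mulmxDr -scalemxAr hu hv scaler0 addr0.
have Uf : U = fullv.
  apply: sX => [v /hU hv|a]; apply/hU => i; first by rewrite -iterSr.
  have -> : iter i (mulmx X.1.1) (X.1.2 *m a) = krylov X i *m a.
    by elim: i => //= i ->; rewrite mulmxA.
  by rewrite mulmxA hy mul0mx.
apply/rowP => j; rewrite mxE.
have /hU/(_ 0%N)/= : delta_mx j 0 \in U by rewrite Uf memvf.
by rewrite -colE => /matrixP/(_ 0 0); rewrite !mxE.
Qed.

End Krylov.

Definition dual_triple {C : numClosedFieldType} {r0 r1 n : nat}
    (X : triple C r0 r1 n) : triple C r1 r0 n :=
  (X.1.1^T, X.2^T, X.1.2^T).

Section Duality.
Context {C : numClosedFieldType} {r0 r1 n : nat}.
Implicit Types (X : triple C r0 r1 n) (h : 'M[C]_n).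

Lemma dual_tripleK X : dual_triple (dual_triple X) = X.
Proof. by case: X => [[B z] w]; rewrite /dual_triple /= !trmxK. Qed.

Lemma dual_gl_act h X :
  dual_triple (gl_act h X) = gl_act (invmx h)^T (dual_triple X).
Proof.
by rewrite /dual_triple /gl_act /= !trmx_mul -!trmx_inv invmxK mulmxA.
Qed.

Lemma dual_scale_act a x y X :
  dual_triple (scale_act a x y X) = scale_act a y x (dual_triple X).
Proof.
by rewrite /dual_triple /scale_act /= !trmx_mul !tr_diag_mx linearZ.
Qed.

Lemma dual_rigid X : rigid (dual_triple X) -> rigid X.
Proof.
move=> rX a xi a0 xiB xiz wxi; apply: trmx_inj; rewrite trmx0.
(* Transposition exchanges the two sides of the commutation relation, which inverts [a]. *)
apply: (rX a^-1); rewrite ?invr_eq0 //=.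
- by rewrite -trmx_mul -xiB linearZ /= scalerA mulVf // scale1r trmx_mul.
- by rewrite -trmx_mul wxi trmx0.
- by rewrite -trmx_mul xiz trmx0.
Qed.

Lemma dual_krylov X (v : 'cV[C]_n) i :
  X.2 *m iter i (mulmx X.1.1) v = (v^T *m krylov (dual_triple X) i)^T.
Proof.
elim: i v => [|i IH] v; first by rewrite /krylov /= trmx_mul !trmxK.
by rewrite iterSr IH /krylov iterS (trmx_mul X.1.1 v) -mulmxA.
Qed.

(** The [v] with [w B^i v = 0] for all [i] form a [B]-stable subspace inside the kernel of [w];
    transposed, they are the rows annihilating the Krylov matrices of the dual triple. *)
Lemma stable_plus_generating X : stable_plus X -> generating (dual_triple X).
Proof.
move=> sX y hy.
have [| |U hU] := @vspace_of_linear_set C 'cV[C]_n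
  (fun v => forall i, v^T *m krylov (dual_triple X) i = 0).
- by move=> i; rewrite trmx0 mul0mx.
- move=> a u v hu hv i.
  by rewrite linearD linearZ mulmxDl /= -scalemxAl hu hv scaler0 addr0.
have U0 : U = 0%VS.
  apply: sX => [v /hU hv|v /hU hv].
    apply/hU => i; apply: trmx_inj; rewrite -dual_krylov -iterSr dual_krylov.
    by rewrite hv.
  by have := dual_krylov X v 0; rewrite hv trmx0.
have : y^T \in U by apply/hU => i; rewrite trmxK.
by rewrite U0 memv0 => /eqP e; apply: trmx_inj; rewrite e trmx0.
Qed.

Lemma generating_stable_plus X : generating (dual_triple X) -> stable_plus X.
Proof.
move=> gX U UB Uw; apply/eqP; rewrite -subv0; apply/subvP => v vU.
rewrite memv0; apply/eqP/trmx_inj; rewrite trmx0; apply: gX => i.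
apply: trmx_inj; rewrite -dual_krylov trmx0 Uw //.
by elim: i => //= i; apply: UB.
Qed.

End Duality.

(** * Normal form of torus-fixed triples *)

Lemma col_mul (R : pzRingType) (m n p : nat) (j : 'I_p) (A : 'M[R]_(m, n)) B :
  col j (A *m B) = A *m col j B.
Proof. by rewrite !colE mulmxA. Qed.

Section Chains.
Context {C : numClosedFieldType} {r0 r1 n : nat}.
Implicit Types (X : triple C r0 r1 n) (h g : 'M[C]_n) (f : 'I_n -> 'I_r0 * nat).

(* f numbers the basis vectors B^i z_a with i < k a. *)
Definition chain_index (k : 'I_r0 -> nat) f : Prop :=
  injective f /\ forall a i, (exists j, f j = (a, i)) <-> (i < k a)%N.

(** A nilpotent Jordan form with one block per chain. The column of [B] at the end of a chain
    vanishes because [f] takes no value beyond it, and so does [z_a] when the chain of [a] is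
    empty. *)
Definition chain_triple f : triple C r0 r1 n :=
  (\matrix_(i, j) (f i == ((f j).1, (f j).2.+1))%:R,
   \matrix_(i, a) (f i == (a, 0%N))%:R, 0).

(** An invariant of the GL(V)-orbit, which tells models with different [k] apart. *)
Definition chain_shape X (k : 'I_r0 -> nat) : Prop :=
  forall a i, (col a (krylov X i) != 0) = (i < k a)%N.

Lemma chain_index_exists (k : 'I_r0 -> nat) :
  (\sum_a k a = n)%N -> exists f, chain_index k f.
Proof.
move=> kn.
pose s := [seq (a, i) | a <- enum 'I_r0, i <- iota 0 (k a)].
have ss : size s == n.
  rewrite size_allpairs_dep -kn sumnE big_map big_enum /=.
  by apply/eqP/eq_bigr => a _; rewrite size_iota.
have us : uniq s.
  apply: allpairs_uniq_dep => [|a _|]; [exact: enum_uniq|exact: iota_uniq|].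
  by move=> [a i] [b j] _ _ /= [-> ->].
have ms a i : ((a, i) \in s) = (i < k a)%N.
  apply/allpairsPdep/idP => [[b [j [_ hj [-> ->]]]]|ia].
    by move: hj; rewrite mem_iota add0n.
  by exists a, i; rewrite mem_enum mem_iota add0n.
exists (tnth (Tuple ss)); split=> [|a i]; first by apply/tuple_uniqP.
rewrite -ms; split=> [[j <-]|/(tnthP (Tuple ss)) [j ->]]; last by exists j.
exact: (mem_tnth j (Tuple ss)).
Qed.

Section Normal.
Context (k : 'I_r0 -> nat) (f : 'I_n -> 'I_r0 * nat) (kf : chain_index k f).

Lemma chain_index_lt j : ((f j).2 < k (f j).1)%N.
Proof. by apply/(proj2 kf); exists j; rewrite -surjective_pairing. Qed.

Lemma krylov_chain i : krylov (chain_triple f) i = \matrix_(l, a) (f l == (a, i))%:R.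
Proof.
case: kf => f_inj f_im.
elim: i => [//|i IH].
rewrite /krylov iterS -/(krylov _ _) IH; apply/matrixP => l a; rewrite !mxE.
case: (f l =P (a, i.+1)) => [e|ne].
  have [j ej] : exists j, f j = (a, i).
    by apply/f_im/ltnW/f_im; exists l.
  rewrite (bigD1 j) //= !mxE ej e !eqxx mulr1 big1 ?addr0 // => m mj.
  rewrite !mxE; case: eqP => [em|_]; last by rewrite mul0r.
  case: eqP => [em'|_]; last by rewrite mulr0.
  by rewrite (f_inj m j) ?eqxx // in mj; rewrite em'.
apply: big1 => j _; rewrite !mxE.
case: (f j =P (a, i)) => [ej|_]; last by rewrite mulr0.
by rewrite ej /=; case: eqP => [//|_]; rewrite mul0r.
Qed.

Lemma chain_generating : generating (chain_triple f).
Proof.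
case: kf => f_inj _.
move=> y hy; apply/rowP => j; rewrite mxE.
have := hy (f j).2; rewrite krylov_chain => /matrixP/(_ 0 (f j).1).
rewrite !mxE (bigD1 j) //= mxE -surjective_pairing eqxx mulr1 big1 ?addr0 //.
move=> l lj; rewrite mxE -surjective_pairing.
case: eqP => [/f_inj e|_]; last by rewrite mulr0.
by rewrite e eqxx in lj.
Qed.

Lemma chain_shape_gl h : h \in unitmx ->
  chain_shape (gl_act h (chain_triple f)) k.
Proof.
case: kf => f_inj f_im.
move=> uh a i; rewrite krylov_gl // col_mul.
have -> : (h *m col a (krylov (chain_triple f) i) != 0) =
    (col a (krylov (chain_triple f) i) != 0).
  congr (~~ _); apply/eqP/eqP => [/(congr1 (mulmx (invmx h)))|->].
    by rewrite mulKmx // mulmx0.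
  by rewrite mulmx0.
rewrite krylov_chain; apply/idP/idP => [ne|/f_im [j ej]].
  apply/f_im; move: ne; apply: contraNP => hn.
  apply/eqP/colP => j; rewrite !mxE.
  by case: eqP => // ej; case: hn; exists j.
by apply/eqP => /colP/(_ j)/eqP; rewrite !mxE ej eqxx oner_eq0.
Qed.

Lemma chain_stable_minus : stable_minus (chain_triple f).
Proof.
move=> U UB Uz; apply/eqP; rewrite eqEsubv subvf /=; apply/subvP => v _.
have Ud j : delta_mx j 0 \in U.
  have -> : delta_mx j 0 = krylov (chain_triple f) (f j).2 *m
      (delta_mx (f j).1 0 : 'cV_r0).
    rewrite -colE krylov_chain; apply/colP => l; rewrite !mxE eqxx andbT.
    rewrite -surjective_pairing; congr ((nat_of_bool _)%:R).
    by apply/eqP/eqP => [->|/(proj1 kf)].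
  elim: (f j).2 => [|i IH]; first exact: Uz.
  by rewrite /krylov iterS -mulmxA UB.
rewrite (matrix_sum_delta v); apply: memv_suml => j _; rewrite big_ord1.
by rewrite memvZ.
Qed.

(** The [c] solve [c i * a = c j] for each step of [B] from [j] to [i], and [c j * x a = 1] at the
    start of the chain of [a]. *)
Lemma chain_scale_fixed (a : C) (x : 'I_r0 -> C) (y : 'I_r1 -> C) (c : 'I_n -> C) :
  (forall i, x i != 0) -> a != 0 ->
  (forall j, c j = (x (f j).1)^-1 * a^-1 ^+ (f j).2) ->
  gl_act (diag_mx (\row_j c j)) (scale_act a x y (chain_triple f)) = chain_triple f.
Proof.
move=> x0 a0 hc; rewrite gl_act_diag; last first.
  by move=> j; rewrite hc mulf_neq0 ?expf_neq0 ?invr_eq0.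
rewrite /scale_act /= mul_mx_diag mulmx0; congr (_, _, _).
- apply/matrixP => i j; rewrite !mxE.
  case: eqP => [e|_]; last by rewrite !(mulr0, mul0r).
  rewrite !hc e /= exprSr mulr1 mulrA mulfVK ?mulfV //.
  by rewrite !mulf_neq0 ?expf_neq0 ?invr_eq0.
- apply/matrixP => i j; rewrite !mxE.
  case: eqP => [e|_]; last by rewrite !(mulr0, mul0r).
  by rewrite !hc e /= mulr1 mul1r mulVf.
- by apply/matrixP => i j; rewrite !mxE mul0r.
Qed.

End Normal.

(** Invariance at a single point [(a, x, y)] suffices once the eigenvalues are separated there.
    Exponents run up to [n] inclusive, so that each chain has [n + 1] candidate vectors and must end
    by a dimension count. *)
Lemma chain_normal_form X (a : C) (x : 'I_r0 -> C) (y : 'I_r1 -> C) g :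
  g \in unitmx -> gl_act g (scale_act a x y X) = X -> generating X ->
  a != 0 -> (forall i, x i != 0) ->
  (forall p q : 'I_r0 * 'I_n.+1, x p.1 * a ^+ p.2 = x q.1 * a ^+ q.2 -> p = q) ->
  (forall i j (l : 'I_n.+1), y j * x i * a ^+ l != 1) ->
  exists k : {ffun 'I_r0 -> 'I_n.+1},
    [/\ (\sum_i k i)%N = n, chain_shape X (fun i => k i) &
      forall f, chain_index (fun i => k i) f ->
        exists2 h, h \in unitmx & X = gl_act h (chain_triple f)].
Proof.
move=> ug gX genX a0 x0 x_inj xy1.
pose v (b : 'I_r0) i := col b (krylov X i).
have vS b i : v b i.+1 = X.1.1 *m v b i by rewrite /v /krylov iterS col_mul.
have gB : X.1.1 *m g = a *: (g *m X.1.1).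
  by rewrite -{1}gX /= mulmxKV // scalemxAr.
have gv b i : g *m v b i = (x b * a ^+ i)^-1 *: v b i.
  elim: i => [|i IH].
    have : x b *: (g *m v b 0%N) = v b 0%N.
      rewrite /v /krylov /= -[in RHS]gX /= col_mul scalemxAr; congr (_ *m _).
      by rewrite mul_mx_diag; apply/colP => j; rewrite !mxE mulrC.
    by move=> e; rewrite -[in RHS]e expr0 mulr1 scalerA mulVf // scale1r.
  have gB' : g *m X.1.1 = a^-1 *: (X.1.1 *m g).
    by rewrite gB scalerA mulVf // scale1r.
  rewrite vS mulmxA gB' -scalemxAl -mulmxA IH -scalemxAr scalerA exprSr mulrA.
  by rewrite [in RHS]invfM mulrC.
pose J : finType := {p : 'I_r0 * 'I_n.+1 | v p.1 p.2 != 0}.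
pose vJ (p : J) := v (val p).1 (val p).2.
have vJI : lin_indep vJ.
  apply: (@eigen_lin_indep C n J g (fun p => (x (val p).1 * a ^+ (val p).2)^-1)).
  - by move=> p q /invr_inj/x_inj/val_inj.
  - by move=> p; apply: gv.
  - by move=> p; apply: valP p.
have J_le : (#|J| <= n)%N.
  have <- := dim_sum_lines predT vJI.
  apply: leq_trans (dimvS (subvf _)) _; rewrite dimvf dim_matrix.
  exact: eq_leq (muln1 n).
have v_add0 b i j : (i <= j)%N -> v b i = 0 -> v b j = 0.
  move=> /subnK <- vi; elim: (j - i)%N => [//|l IH].
  by rewrite addSn vS IH mulmx0.
(* If [B^n z_b] were nonzero, so would be all [B^i z_b] with [i <= n], which gives more than [n]
   elements of [J]. *)
have v_ex b : exists i, v b i == 0.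
  exists n; apply: contraT => vn.
  have v0 (i : 'I_n.+1) : v b i != 0.
    by apply: contra vn => /eqP; move/(v_add0 b i n); rewrite -ltnS => ->.
  pose emb i : J := exist _ (b, i) (v0 i).
  have emb_inj : injective emb by move=> i j /(congr1 val) [].
  by have := leq_card emb emb_inj; rewrite card_ord leqNgt ltnS J_le.
pose k0 b := ex_minn (v_ex b).
have k0E b i : (v b i != 0) = (i < k0 b)%N.
  rewrite /k0; case: ex_minnP => m /eqP vm mmin.
  by rewrite ltnNge; congr (~~ _); apply/eqP/idP => [/eqP/mmin//|/v_add0/(_ vm)].
have k0_le b : (k0 b < n.+1)%N.
  rewrite ltnNge; apply/negP => lt.
  have v0 (i : 'I_n.+1) : v b i != 0 by rewrite k0E (leq_trans (ltn_ord i)).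
  pose emb i : J := exist _ (b, i) (v0 i).
  have emb_inj : injective emb by move=> i j /(congr1 val) [].
  by have := leq_card emb emb_inj; rewrite card_ord leqNgt ltnS J_le.
pose k := [ffun b => Ordinal (k0_le b)].
have shapeX : chain_shape X (fun i => k i) by move=> b i; rewrite ffunE /= -k0E.
have v_gen (y' : 'rV_n) : (forall p : J, y' *m vJ p = 0) -> y' = 0.
  move=> y'J; apply: genX => i; apply/rowP => b.
  have <- : (y' *m v b i) 0 0 = (y' *m krylov X i) 0 b by rewrite -col_mul mxE.
  have [->|ne] := eqVneq (v b i) 0; first by rewrite mulmx0 !mxE.
  have lt : (i < n.+1)%N by apply: ltn_trans (k0_le b); rewrite -k0E.
  by have := y'J (exist _ (b, Ordinal lt) ne); rewrite /vJ /= => ->; rewrite !mxE.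
(* A row vector annihilating all [vJ] is zero, so the matrix with these columns has full row
   rank. *)
have J_ge : (n <= #|J|)%N.
  pose M := \matrix_(i < n, q < #|J|) vJ (enum_val q) i 0.
  have /eqP <- : row_free M; last exact: rank_leq_col.
  apply: inj_row_free => y' y'M; apply: v_gen => p.
  have <- : col (enum_rank p) M = vJ p.
    by apply/colP => i; rewrite !mxE enum_rankK.
  by rewrite -col_mul y'M; apply/colP => i; rewrite !mxE.
(* The [n] elements of [J] are counted chain by chain. *)
have sum_k : (\sum_i k i)%N = n.
  have eJ : #|J| = n by apply/eqP; rewrite eqn_leq J_le.
  rewrite -[RHS]eJ card_sig -sum1_card.
  rewrite -(pair_big_dep predT (fun b (i : 'I_n.+1) => v b i != 0) (fun _ _ => 1%N)) /=.
  apply: eq_bigr => b _; under eq_bigl do rewrite k0E.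
  rewrite -(big_ord_widen n.+1 (fun=> 1%N)); last exact: ltnW (k0_le b).
  by rewrite sum1_card card_ord ffunE.
exists k; split=> // f kf.
have krylov_z b : col b X.1.2 = v b 0%N by [].
clearbody v.
pose h := \matrix_(i, j) v (f j).1 (f j).2 i 0.
have hf j : col j h = v (f j).1 (f j).2.
  by apply/colP => i; rewrite !mxE.
have uh : h \in unitmx.
  rewrite -row_free_unit; apply: inj_row_free => y' y'h; apply: v_gen => p.
  have [j ej] : exists j, f j = ((val p).1, (val p).2 : nat).
    by apply/(proj2 kf); rewrite ffunE /= -k0E (valP p).
  have <- : col j h = vJ p by rewrite hf ej.
  by rewrite -col_mul y'h; apply/colP => i; rewrite !mxE.
have h_sel b i : h *m (\col_l (f l == (b, i))%:R) = v b i.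
  apply/colP => m; rewrite mxE.
  have [vi|] := eqVneq (v b i) 0.
    rewrite vi mxE big1 // => l _; rewrite !mxE.
    by case: eqP => [->|_]; rewrite ?mulr0 //= vi mxE mul0r.
  rewrite k0E => lt; have [j ej] : exists j, f j = (b, i).
    by apply/(proj2 kf); rewrite ffunE.
  rewrite (bigD1 j) //= !mxE ej eqxx mulr1 big1 ?addr0 // => l lj.
  rewrite !mxE; case: eqP => [el|_]; last by rewrite mulr0.
  by rewrite (proj1 kf l j) ?eqxx ?el // in lj.
have Bh : X.1.1 *m h = h *m (chain_triple f).1.1.
  apply/matrixP => i j.
  have -> : (X.1.1 *m h) i j = (X.1.1 *m col j h) i 0.
    by rewrite -col_mul [in RHS]mxE.
  rewrite hf -vS -h_sel !mxE; apply: eq_bigr => l _; rewrite !mxE.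
  done.
have zh : X.1.2 = h *m (chain_triple f).1.2.
  apply/matrixP => i b.
  have -> : X.1.2 i b = col b X.1.2 i 0 by rewrite mxE.
  by rewrite krylov_z -h_sel !mxE; apply: eq_bigr => l _; rewrite !mxE.
(* Evaluate [w g = diag(y) w] on the eigenvector [B^l z_b] of eigenvalue [(x b * a ^ l)^-1]: a
   nonzero entry [i] of [w B^l z_b] would force [y i * x b * a ^ l = 1]. *)
have wh : X.2 *m h = 0.
  have wg : X.2 *m g = diag_mx (\row_j y j) *m X.2.
    by rewrite -{1}gX /= mulmxKV.
  apply/matrixP => i j; rewrite [RHS]mxE.
  have -> : (X.2 *m h) i j = (X.2 *m v (f j).1 (f j).2) i 0.
    by rewrite -hf -col_mul [in RHS]mxE.
  have lt : ((f j).2 < n.+1)%N.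
    apply: ltn_trans (k0_le (f j).1); have := proj2 kf (f j).1 (f j).2.
    by rewrite ffunE => <-; exists j; rewrite -surjective_pairing.
  have := congr1 (mulmx^~ (v (f j).1 (f j).2)) wg.
  rewrite -!mulmxA gv -scalemxAr mul_diag_mx => /matrixP/(_ i 0)/eqP.
  move: (_ *m _) => M; rewrite 3!mxE -subr_eq0 -mulrBl mulf_eq0 => /orP[|/eqP//].
  rewrite subr_eq0 => /eqP e; have := xy1 (f j).1 i (Ordinal lt).
  by rewrite -e /= -mulrA mulVf ?eqxx // mulf_neq0 ?expf_neq0.
exists h => //; rewrite /gl_act /= -Bh mulmxK // -zh mul0mx.
rewrite [LHS]surjective_pairing [X in (X, _) = _]surjective_pairing.
by congr (_, _, _); rewrite -[LHS](mulmxK uh) wh mul0mx.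
Qed.

End Chains.

(** * Euler classes *)

Section EulerClasses.
Context {m : nat}.
Implicit Types (chi : char m).

Lemma mpolyX_neq0 (R : nzRingType) (k : 'X_{1..m}) : 'X_[k] != 0 :> {mpoly R[m]}.
Proof.
apply/eqP => /(congr1 (mcoeff k)); rewrite mcoeffX eqxx mcoeff0 => /eqP.
by rewrite oner_eq0.
Qed.

Lemma tvar_neq0 (i : 'I_m) : tvar i != 0.
Proof. by rewrite tofrac_eq0 mpolyX_neq0. Qed.

(** Clearing denominators equates the monomials of the positive and of the negative exponents, whose
    supports are disjoint. *)
Lemma char_eval_tvar_eq1 chi : char_eval (@tvar m) chi = 1 -> chi = 0.
Proof.
pose p := [multinom (if chi i is Posz a then a else 0%N) | i < m].
pose n := [multinom (if chi i is Negz a then a.+1 else 0%N) | i < m].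
have evE (k : 'X_{1..m}) : \prod_i tvar i ^+ k i = FracField.tofrac ('X_[k] : {mpoly rat[m]}).
  by rewrite mpolyXE_id rmorph_prod; apply: eq_bigr => i _; rewrite rmorphXn.
have -> : char_eval (@tvar m) chi = \prod_i tvar i ^+ p i / \prod_i tvar i ^+ n i.
  rewrite -prodf_div; apply: eq_bigr => i _; rewrite !mnmE.
  by case: (chi i) => a; rewrite ?expr0 ?divr1 ?mul1r.
move/eqP; rewrite !evE; rewrite -subr_eq0.
move/eqP/(congr1 (fun x => x * FracField.tofrac ('X_[n] : {mpoly rat[m]}))).
rewrite mul0r mulrBl mul1r mulfVK; last by rewrite tofrac_eq0 mpolyX_neq0.
move/eqP; rewrite subr_eq0 tofrac_eq => /eqP/(congr1 (mcoeff n)).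
rewrite !mcoeffX eqxx; case: eqP => // e _; apply/ffunP => i; rewrite ffunE.
have := congr1 (fun k : 'X_{1..m} => k i) e; rewrite !mnmE.
by case: (chi i) => // a ->.
Qed.

(** Off the image of [wt] the exponent is 0 and the factor 1, so the product over the lattice is
    finite and can be regrouped by [j]. The class has to be a sum of characters without subtraction,
    a form the tangent class takes after telescoping. *)
Lemma EuK_sum (J : finType) (wt : J -> char m) :
  EuK (fun w => \sum_j (wt j == w)%:Z) =
  \prod_j (1 - (char_eval (@tvar m) (wt j))^-1).
Proof.
have prodE w : (1 - (char_eval (@tvar m) w)^-1) ^ (\sum_j (wt j == w)%:Z) =
    \prod_(j | wt j == w) (1 - (char_eval (@tvar m) (wt j))^-1).
  rewrite [RHS]big_mkcond.
  have -> : (\sum_j (wt j == w)%:Z) = (\sum_j (wt j == w))%N%:Z.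
    by rewrite -[RHS]intz sumMz; apply: eq_bigr => j _; rewrite intz.
  rewrite -exprnP -prodrXr; apply: eq_bigr => j _.
  by case: eqP => [->|_]; rewrite ?expr1 ?expr0.
rewrite /EuK (fsbigE (undup (codom wt))) ?undup_uniq //; last first.
  move=> w _; rewrite mem_undup prodE => nw; apply: big_pred0 => j.
  by apply: contraNF nw => /eqP <-; apply: codom_f.
under eq_bigl do rewrite in_setT; under eq_bigr do rewrite prodE.
rewrite (exchange_big_dep predT) //=; apply: eq_bigr => j _.
rewrite big_mkcond (bigD1_seq (wt j)) ?undup_uniq ?mem_undup ?codom_f //= eqxx.
by rewrite big1 ?mulr1 // => w; rewrite eq_sym => /negbTE ->.
Qed.

End EulerClasses.

(** * The Vandermonde identity *)

Section PairProducts.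

(** Cancellation takes place between the terms at [(a, b)] and [(b, a)]. The law is general in order
    to cover products in the field as well as sums of exponents. *)
Lemma big_pair_split (R : Type) (idx : R) (op : Monoid.com_law idx) (s : nat)
    (G : 'I_s -> 'I_s -> R) :
  \big[op/idx]_a \big[op/idx]_b G a b =
  op (\big[op/idx]_a G a a)
     (\big[op/idx]_(a < s) \big[op/idx]_(b < s | (a < b)%N) op (G a b) (G b a)).
Proof.
have -> : \big[op/idx]_a \big[op/idx]_b G a b =
    \big[op/idx]_(a < s) op (G a a) (op (\big[op/idx]_(b < s | (a < b)%N) G a b)
      (\big[op/idx]_(b < s | (b < a)%N) G a b)).
  apply: eq_bigr => a _; rewrite (bigD1 a) //=; congr (op _ _).
  rewrite (bigID (fun b : 'I_s => (a < b)%N)) /=; congr (op _ _); apply: eq_bigl => b.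
    by case: ltngtP => //; rewrite ?andbF // -val_eqE /= => /gtn_eqF ->.
  by rewrite -leqNgt ltn_neqAle val_eqE.
rewrite !big_split /=; congr (op _ _).
under [in RHS]eq_bigr do rewrite big_split /=.
rewrite big_split /=; congr (op _ _).
by rewrite (exchange_big_dep predT).
Qed.

Lemma half_mul_succK n : ((n * n.+1)./2 * 2 = n * n.+1)%N.
Proof. by rewrite muln2 halfK oddM oddS andbN subn0. Qed.

Lemma half_mul_succS n : ((n.+1 * n.+2)./2 = (n * n.+1)./2 + n.+1)%N.
Proof.
apply/eqP; rewrite -(eqn_pmul2r (isT : 0 < 2)%N) mulnDl !half_mul_succK.
by rewrite (mulnC n) -mulnDr addn2.
Qed.

(** Bookkeeping for the powers of [q]: diagonal factors contribute triangular numbers, and each pair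
    contributes [k a * k b]. After doubling, it is the expansion of the square of [N]. *)
Lemma half_mul_succ_sum (s : nat) (k : 'I_s -> nat) (N := (\sum_a k a)%N) :
  ((N * N.+1)./2 = \sum_a (k a * (k a).+1)./2 +
     \sum_(a < s) \sum_(b < s | (a < b)%N) k a * k b)%N.
Proof.
apply/eqP; rewrite -(eqn_pmul2r (isT : 0 < 2)%N) mulnDl half_mul_succK mulnS.
rewrite big_distrlr /= (big_pair_split _ (fun a b => k a * k b)%N) addnA.
apply/eqP; congr (_ + _)%N.
  rewrite -big_split big_distrl /=; apply: eq_bigr => a _.
  by rewrite half_mul_succK mulnS.
rewrite big_distrl; apply: eq_bigr => a _; rewrite big_distrl.
by apply: eq_bigr => b _; rewrite /= (mulnC (k b)) addnn -muln2.
Qed.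

(* Both sides are the product of g over the integers from - l to k. *)
Lemma prod_shift_split (R : comPzRingType) (g : int -> R) (k l : nat) :
  (\prod_(i < l) g (- i%:Z - 1)) * (g 0 * \prod_(i < k) g (i%:Z + 1)) =
  (\prod_(i < k) g (i%:Z - l%:Z)) *
    (g (k%:Z - l%:Z) * \prod_(i < l) g (k%:Z - i%:Z)).
Proof.
transitivity (\prod_(j < l + k.+1) g (j%:Z - l%:Z)).
  rewrite big_split_ord /= big_ord_recl /= addn0 subrr; congr (_ * (_ * _)).
    rewrite (reindex_inj rev_ord_inj); apply: eq_bigr => i _ /=; congr g.
    by have := ltn_ord i; lia.
  by apply: eq_bigr => i _; congr g; rewrite /bump /=; lia.
rewrite addnS addnC -addnS big_split_ord /= big_ord_recl /= addn0.
congr (_ * (_ * _)); rewrite (reindex_inj rev_ord_inj); apply: eq_bigr => i _ /=.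
by congr g; rewrite /bump /=; have := ltn_ord i; lia.
Qed.

End PairProducts.

Section DeltaIdentity.
Context {F : fieldType} {q : F} (q0 : q != 0).

Lemma one_subV (y : F) : y != 0 -> 1 - y^-1 = - y^-1 * (1 - y).
Proof. by move=> y0; rewrite mulrBr mulr1 mulNr mulVf // opprK addrC. Qed.

Lemma divNV_mul (a b y z : F) : (- a^-1 * y) / (- b^-1 * z) = b / a * (y / z).
Proof. by rewrite invfM invrN invrK mulrACA mulrNN (mulrC _ b). Qed.

(** Reversing the denominators pairs [1 - q^(i+1)] with [1 - q^-(i+1)], and each such quotient is
    [- q^(i+1)]. *)
Lemma diagonal_factor (k : nat) : (forall i, q ^+ i.+1 != 1) ->
  \prod_(i < k) ((1 - q ^+ i.+1) / (1 - q ^ (i%:Z - k%:Z))) =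
  (-1) ^+ k * q ^+ (k * k.+1)./2.
Proof.
move=> q1; rewrite prodf_div.
have -> : \prod_(i < k) (1 - q ^ (i%:Z - k%:Z)) =
    \prod_(i < k) (- q ^- i.+1 * (1 - q ^+ i.+1)).
  rewrite (reindex_inj rev_ord_inj); apply: eq_bigr => i _ /=.
  rewrite -one_subV ?expf_neq0 // exprnN; congr (1 - q ^ _).
  by have := ltn_ord i; lia.
rewrite -prodf_div; elim: k => [|k IH]; first by rewrite big_ord0 mulr1.
rewrite half_mul_succS big_ord_recr /= IH exprD [(-1) ^+ k.+1]exprSr.
have -> : (1 - q ^+ k.+1) / (- q ^- k.+1 * (1 - q ^+ k.+1)) = - q ^+ k.+1.
  rewrite invfM mulrCA mulfV ?mulr1 ?invrN ?invrK //.
  by rewrite subr_eq0 eq_sym q1.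
by rewrite mulrN1 mulrN mulNr mulrA.
Qed.

(** All factors are values of [g e = 1 - q ^ e * u], those in [u^-1] after extraction of a monomial.
    By [prod_shift_split] they cancel down to [g (k - l) / g 0], the Vandermonde quotient of the
    pair. *)
Lemma off_diagonal_factor (u : F) (k l : nat) : u != 0 ->
  (forall e : int, q ^ e * u != 1) ->
  (\prod_(i < l) ((1 - q ^+ i.+1 / u) / (1 - q ^ (i%:Z - k%:Z) / u))) *
  (\prod_(i < k) ((1 - q ^+ i.+1 * u) / (1 - q ^ (i%:Z - l%:Z) * u))) =
  q ^+ (k * l) * ((q ^+ k * u - q ^+ l) / (u - 1)).
Proof.
move=> u0 qu1; pose g (e : int) := 1 - q ^ e * u.
have g0 e : g e != 0 by rewrite subr_eq0 eq_sym qu1.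
have gV e : 1 - q ^ (- e) / u = - (q ^ e * u)^-1 * g e.
  by rewrite -one_subV ?mulf_neq0 ?expfz_neq0 // invfM invr_expz.
have -> : \prod_(i < l) ((1 - q ^+ i.+1 / u) / (1 - q ^ (i%:Z - k%:Z) / u)) =
    \prod_(i < l) (q ^+ k.+1 * (g (- i%:Z - 1) / g (k%:Z - i%:Z))).
  apply: eq_bigr => i _.
  have -> : q ^+ i.+1 = q ^ (- (- i%:Z - 1)).
    by rewrite exprnP; congr (q ^ _); lia.
  have -> : q ^ (i%:Z - k%:Z) = q ^ (- (k%:Z - i%:Z)) by congr (q ^ _); lia.
  rewrite !gV divNV_mul invfM (mulrACA _ u) mulfV // mulr1 invr_expz -expfzDr //.
  by rewrite exprnP; congr (q ^ _ * _); lia.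
have -> : \prod_(i < k) ((1 - q ^+ i.+1 * u) / (1 - q ^ (i%:Z - l%:Z) * u)) =
    \prod_(i < k) (g (i%:Z + 1) / g (i%:Z - l%:Z)).
  by apply: eq_bigr => i _; rewrite exprnP /g; congr ((1 - q ^ _ * u) / _); lia.
rewrite big_split /= prodr_const card_ord !prodf_div.
have := prod_shift_split g k l.
set A := \prod_(i < l) _; set B := \prod_(i < k) _; set D := \prod_(i < k) _.
set E := \prod_(i < l) _ => e.
have D0 : D != 0 by apply/prodf_neq0 => i _.
have E0 : E != 0 by apply/prodf_neq0 => i _.
have -> : (q ^+ k.+1) ^+ l * (A / E) * (B / D) = (q ^+ k.+1) ^+ l * (g (k%:Z - l%:Z) / g 0).
  rewrite -mulrA; congr (_ * _); apply: (mulIf (g0 0)); rewrite divfK //.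
  apply: (mulIf D0); apply: (mulIf E0); rewrite -[RHS]mulrA [D * E]mulrC.
  have -> : A / E * (B / D) * g 0 * D * E = A * (g 0 * B).
    by field; rewrite D0 E0.
  by rewrite e; ring.
have -> : g 0 = - (u - 1) by rewrite /g expr0z mul1r opprB.
have -> : g (k%:Z - l%:Z) = - (q ^+ k * u - q ^+ l) * q ^- l.
  by rewrite /g expfzDr // opprB mulrBl mulfV ?expf_neq0 // -exprnN mulrAC.
have u1 : u - 1 != 0 by rewrite subr_eq0; have := qu1 0; rewrite expr0z mul1r.
rewrite -exprM mulSn exprD; have := expf_neq0 l q0.
move: (q ^+ (k * l)) (q ^+ l) (q ^+ k) => Q Ql Qk Ql0.
by field; rewrite ?oppr_eq0 u1 Ql0.
Qed.

(** After multiplying and dividing by the Pochhammer symbols, [diagonal_factor] yields the sign and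
    the triangular powers of [q], and [off_diagonal_factor] yields one factor of the Vandermonde
    quotient per pair. Genericity of [x] keeps the denominators nonzero. *)
Lemma Delta_identity (s : nat) (x : 'I_s -> F) (k : 'I_s -> nat)
    (N := (\sum_a k a)%N) :
  (forall i, q ^+ i.+1 != 1) -> (forall a, x a != 0) ->
  (forall a b (e : int), a != b -> q ^ e * (x a / x b) != 1) ->
  \prod_a \prod_b \prod_(i < k b) (1 - q ^ (i%:Z - (k a)%:Z) * (x b / x a))^-1 =
  (-1) ^+ N * q ^+ (N * N.+1)./2 *
  (Delta (fun a => q ^+ k a * x a) / Delta x) /
  (\prod_a \prod_b qpoch q (q * x b / x a) (k b)).
Proof.
move=> q1 x0 qx1.
have Q0 a b (i : nat) : 1 - q ^+ i * (q * x b / x a) != 0.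
  rewrite subr_eq0 eq_sym -!mulrA mulrA -exprSr; have [->|ab] := eqVneq a b.
    by rewrite mulfV // mulr1.
  by apply: (qx1 b a i.+1); rewrite eq_sym.
have -> : \prod_a \prod_b \prod_(i < k b)
      (1 - q ^ (i%:Z - (k a)%:Z) * (x b / x a))^-1 =
    (\prod_a \prod_b \prod_(i < k b) ((1 - q ^+ i.+1 * (x b / x a)) /
       (1 - q ^ (i%:Z - (k a)%:Z) * (x b / x a)))) /
    (\prod_a \prod_b qpoch q (q * x b / x a) (k b)).
  rewrite -prodf_div; apply: eq_bigr => a _; rewrite -prodf_div.
  apply: eq_bigr => b _; rewrite -prodf_div; apply: eq_bigr => i _.
  rewrite exprSr -[q ^+ i * q * _]mulrA [q * (_ / _)]mulrA.
  by rewrite mulrAC mulfV ?mul1r.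
have prod_pair_split (G : 'I_s -> 'I_s -> F) : \prod_a \prod_b G a b =
    (\prod_a G a a) * \prod_(a < s) \prod_(b < s | (a < b)%N) (G a b * G b a).
  exact: big_pair_split.
congr (_ / _); rewrite prod_pair_split.
have diagE a :
   \prod_(i < k a) ((1 - q ^+ i.+1 * (x a / x a)) /
       (1 - q ^ (i%:Z - (k a)%:Z) * (x a / x a))) =
   (-1) ^+ k a * q ^+ (k a * (k a).+1)./2.
  by rewrite -diagonal_factor //; apply: eq_bigr => i _; rewrite mulfV // !mulr1.
under eq_bigr do rewrite diagE.
rewrite /= big_split /= !prodrXr -!mulrA; congr (_ * _).
have pairE (a b : 'I_s) : (a < b)%N ->
   (\prod_(i < k b) ((1 - q ^+ i.+1 * (x b / x a)) /
       (1 - q ^ (i%:Z - (k a)%:Z) * (x b / x a)))) *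
   (\prod_(i < k a) ((1 - q ^+ i.+1 * (x a / x b)) /
       (1 - q ^ (i%:Z - (k b)%:Z) * (x a / x b)))) =
   q ^+ (k a * k b) * ((q ^+ k a * x a - q ^+ k b * x b) / (x a - x b)).
  move=> ltab; have ab : a != b by rewrite -val_eqE /= ltn_eqF.
  have u0 : x a / x b != 0 by rewrite mulf_neq0 ?invr_eq0.
  have := off_diagonal_factor (k a) (k b) u0 (fun e => qx1 a b e ab).
  rewrite invf_div => ->; congr (_ * _).
  have -> : x a / x b - 1 = (x a - x b) / x b by rewrite mulrBl mulfV.
  have -> : q ^+ k a * (x a / x b) - q ^+ k b = (q ^+ k a * x a - q ^+ k b * x b) / x b.
    by rewrite mulrBl mulfK // mulrA.
  by rewrite invf_div mulrA mulfVK.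
rewrite (eq_bigr _ (fun a _ => eq_bigr _ (pairE a))).
under [X in _ * X = _]eq_bigr do rewrite big_split /= prodrXr prodf_div.
by rewrite big_split /= prodrXr prodf_div mulrA -exprD -half_mul_succ_sum.
Qed.

End DeltaIdentity.

(** * Localization *)

Section Localization.
Context {C : numClosedFieldType} {r0 r1 n s : nat}.
Let r := (r0 + r1)%N.
Context (st : set (triple C r0 r1 n))
  (Lambda : triple C r0 r1 n -> kclass (tdim r))
  (model : ('I_n -> 'I_s * nat) -> triple C r0 r1 n)
  (term : ('I_s -> nat) -> ratfun (tdim r)).
Implicit Types (X : triple C r0 r1 n) (k : {ffun 'I_s -> 'I_n.+1}).

(** Ranging over all numberings [f] allows two orbits with the same [k] to be compared with one and
    the same model. *)
Let normal X k := (\sum_a k a)%N = n /\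
  forall f, chain_index (fun a => k a) f ->
    exists2 h, h \in unitmx & X = gl_act h (model f).

Hypothesis normalize : forall X h, st X -> h \in unitmx ->
  (forall t, torus t -> exists2 g, g \in unitmx &
    gl_act g (torus_act t (gl_act h X)) = gl_act h X) ->
  exists k, normal (gl_act h X) k.
Hypothesis model_stable : forall (k : 'I_s -> nat) f, chain_index k f -> st (model f).
Hypothesis model_fixed : forall (k : 'I_s -> nat) f, chain_index k f ->
  exists d, diag_fixed d (model f).
Hypothesis model_inj : forall (k k' : 'I_s -> nat) f f' h,
  chain_index k f -> chain_index k' f' -> h \in unitmx ->
  model f = gl_act h (model f') -> k =1 k'.
Hypothesis model_term : forall (k : 'I_s -> nat) f h,
  chain_index k f -> h \in unitmx -> (\sum_a k a)%N = n ->
  EuK (Lambda (gl_act h (model f))) / EuK (tangent_class (gl_act h (model f))) =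
  term k.

(* K_integral evaluates its classes at an arbitrary point of each orbit, hence
   model_term has to hold for every h. *)
Lemma K_integral_chains :
  K_integral st Lambda =
  \sum_(k : {ffun 'I_s -> 'I_n.+1} | (\sum_a k a)%N == n) term (fun a => k a).
Proof.
pose Fix := torus_fixed (gl_quotient st).
pose rep (O : set (triple C r0 r1 n)) := xget 0 O.
pose kO O := xget [ffun=> ord0] [set k | normal (rep O) k].
have orbitE X h : h \in unitmx -> gl_orbit (gl_act h X) = gl_orbit X.
  move=> uh; apply/seteqP; split=> Y [g ug ->].
    by exists (g *m h); rewrite ?unitmx_mul ?ug // gl_actM.
  exists (g *m invmx h); rewrite ?unitmx_mul ?ug ?unitmx_inv //.
  by rewrite gl_actM ?unitmx_mul ?ug ?unitmx_inv // mulmxKV.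
have fixP O : Fix O -> O = gl_orbit (rep O) /\ normal (rep O) (kO O).
  move=> [[X0 stX0 OE] tO].
  have OX : O (rep O).
    apply: (@xgetPex _ 0 O); exists X0; rewrite -OE; exists 1%:M.
      exact: unitmx1.
    by rewrite gl_act1.
  have [h uh hX] : gl_orbit X0 (rep O) by rewrite OE.
  split; first by rewrite hX orbitE.
  apply: (@xgetPex _ [ffun=> ord0] [set k | normal (rep O) k]).
  rewrite hX; apply: normalize => // t tt; rewrite -hX.
  have [g ug ->] : gl_orbit X0 (torus_act t (rep O)).
    have : (image O (torus_act t)) (torus_act t (rep O)) by exists (rep O).
    by rewrite tO // OE.
  exists (h *m invmx g); first by rewrite unitmx_mul uh unitmx_inv.
  by rewrite -gl_actM ?unitmx_inv // gl_actK.
have sumE : \sum_(k : {ffun 'I_s -> 'I_n.+1} | (\sum_a k a)%N == n)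
      term (fun a => k a) =
    \sum_(k \in [set k : {ffun 'I_s -> 'I_n.+1} | (\sum_a k a)%N = n])
      term (fun a => k a).
  rewrite (@bigfs _ _ _ _ (index_enum _)) ?index_enum_uniq //; last first.
    by move=> k _; rewrite mem_index_enum.
  by apply: eq_fsbigl; apply/seteqP; split=> k /= /eqP.
(* [kO] is a bijection from the fixed orbits to the vectors [k] of total [n]; the three properties
   are checked below. *)
rewrite sumE (@reindex_fsbig _ _ _ _ _ kO Fix).
  apply: eq_fsbigr => O; rewrite inE => FO.
  have [_ [kn kX]] := fixP O FO.
  have [f kf] := chain_index_exists kn; have [h uh hX] := kX f kf.
  by rewrite -/(rep O) hX (model_term kf uh kn).
split.
- by move=> O /= /fixP[_ []].
- move=> O O'; rewrite !inE => /fixP[OE [kn kX]] /fixP[OE' [_ kX']] e.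
  have [f kf] := chain_index_exists kn.
  have [h uh hX] := kX f kf; rewrite e in kf; have [h' uh' hX'] := kX' f kf.
  by rewrite OE OE' hX hX' !orbitE.
- move=> k kn; have [f kf] := chain_index_exists kn.
  (* [diag_char d t] undoes [t] on the model, so the torus preserves its orbit. *)
  have FO : Fix (gl_orbit (model f)).
    split; first by exists (model f); first exact: model_stable kf.
    have [d dX] := model_fixed kf.
    move=> t tt; have uD := diag_char_unit d tt.
    apply/seteqP; split=> [_ [Y [g ug ->] <-]|Y [g ug ->]].
      exists (g *m invmx (diag_char d t)); first by rewrite unitmx_mul ug unitmx_inv.
      rewrite torus_act_gl -gl_actM ?unitmx_inv //.
      by rewrite -{2}(dX t tt) gl_actK.
    exists (gl_act (g *m diag_char d t) (model f)).
      by exists (g *m diag_char d t); first by rewrite unitmx_mul ug.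
    by rewrite torus_act_gl -gl_actM // dX.
  exists (gl_orbit (model f)) => //.
  have [_ [k'n kX']] := fixP _ FO.
  have [h uh hX] : gl_orbit (model f) (rep (gl_orbit (model f))).
    apply: (@xgetPex _ 0 (gl_orbit (model f))); exists (model f); exists 1%:M.
      exact: unitmx1.
    by rewrite gl_act1.
  have [f' kf'] := chain_index_exists k'n; have [h' uh' hX'] := kX' f' kf'.
  have uh'h : invmx h' *m h \in unitmx by rewrite unitmx_mul unitmx_inv uh'.
  apply/ffunP => a; apply/val_inj/(model_inj kf' kf uh'h).
  by rewrite -gl_actM ?unitmx_inv // -hX hX' gl_actK.
Qed.

End Localization.

(** * The contribution of a fixed point as an identity in a field *)

Section Combine.
Context {F : fieldType} {q : F} (q0 : q != 0) {s s' : nat}.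
Context (x nu : 'I_s -> F) (m c : 'I_s' -> F) (k : 'I_s -> nat).
Let n := (\sum_a k a)%N.

(** One identity for both signs: [x, nu, m, c] are [e1, mu1, mu0, e0^-1] on the + side and
    [e0^-1, q / mu0, q / mu1, e1] on the - side. Replacing [1 - y^-1] by [1 - y] in the factors with
    [m] and [c] leaves the monomial [q * c a / m a], which occurs [n] times for each [a]. *)
Lemma fixed_point_term :
  (forall i, q ^+ i.+1 != 1) -> (forall a, x a != 0) ->
  (forall a b (e : int), a != b -> q ^ e * (x a / x b) != 1) ->
  (forall a, m a != 0) -> (forall a, c a != 0) ->
  (\prod_a \prod_b \prod_(i < k b) (1 - q ^+ i * (x b * nu a))) *
  (\prod_a \prod_b \prod_(i < k b) (1 - (q ^+ i * (x b * m a))^-1)) /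
  ((\prod_a \prod_b \prod_(i < k b) (1 - q ^ (i%:Z - (k a)%:Z) * (x b / x a))) *
   (\prod_a \prod_b \prod_(i < k b) (1 - (q ^+ i * (q * x b * c a))^-1))) =
  (- \prod_a (q * c a / m a)) ^+ n * q ^+ (n * n.+1)./2 *
  (Delta (fun b => q ^+ k b * x b) / Delta x) *
  (\prod_a \prod_b (qpoch q (x b * nu a) (k b) / qpoch q (q * x b / x a) (k b))) *
  (\prod_b \prod_a (qpoch q (x b * m a) (k b) / qpoch q (q * x b * c a) (k b))).
Proof.
move=> q1 x0 qx1 m0 c0.
have ratioE : (\prod_a \prod_b \prod_(i < k b) (1 - (q ^+ i * (x b * m a))^-1)) /
    (\prod_a \prod_b \prod_(i < k b) (1 - (q ^+ i * (q * x b * c a))^-1)) =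
    (\prod_a (q * c a / m a)) ^+ n *
    (\prod_b \prod_a (qpoch q (x b * m a) (k b) / qpoch q (q * x b * c a) (k b))).
  rewrite -prodf_div [X in _ * X]exchange_big -prodrXl -big_split /=.
  apply: eq_bigr => a _; rewrite -prodf_div -prodrXr -big_split /=.
  apply: eq_bigr => b _; rewrite /qpoch -!prodf_div.
  have -> : (q * c a / m a) ^+ k b = \prod_(i < k b) (q * c a / m a).
    by rewrite prodr_const card_ord.
  rewrite -big_split; apply: eq_bigr => i _.
  have qi : q ^+ i != 0 by rewrite expf_neq0.
  rewrite !one_subV ?mulf_neq0 // divNV_mul; congr (_ * _).
  by field; rewrite qi m0 x0.
have gE : (\prod_a \prod_b \prod_(i < k b)
    (1 - q ^ (i%:Z - (k a)%:Z) * (x b / x a)))^-1 =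
  (-1) ^+ n * q ^+ (n * n.+1)./2 *
  (Delta (fun a => q ^+ k a * x a) / Delta x) /
  (\prod_a \prod_b qpoch q (q * x b / x a) (k b)).
  rewrite -(Delta_identity q0 k q1 x0 qx1).
  rewrite -prodfV; apply: eq_bigr => a _; rewrite -prodfV; apply: eq_bigr => b _.
  by rewrite -prodfV.
rewrite invfM mulrACA ratioE gE.
have -> : \prod_a \prod_b (qpoch q (x b * nu a) (k b) / qpoch q (q * x b / x a) (k b)) =
  (\prod_a \prod_b \prod_(i < k b) (1 - q ^+ i * (x b * nu a))) /
  (\prod_a \prod_b qpoch q (q * x b / x a) (k b)).
  by rewrite -prodf_div; apply: eq_bigr => a _; rewrite -prodf_div.
rewrite -[- \prod_a _]mulN1r exprMn.
ring.
Qed.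

End Combine.

(** * Weights of the tangent space *)

Section ChainSums.
Context {s n : nat} {k : 'I_s -> nat} {f : 'I_n -> 'I_s * nat}.
Hypothesis kf : chain_index k f.

(** [f] is a bijection onto the dependent pairs [(a, i)] with [i < k a]. *)
Lemma big_chain (R : Type) (idx : R) (op : Monoid.com_law idx)
    (G : 'I_s -> nat -> R) :
  \big[op/idx]_j G (f j).1 (f j).2 = \big[op/idx]_a \big[op/idx]_(i < k a) G a i.
Proof.
rewrite (sig_big_dep _ _ (fun a (i : 'I_(k a)) => G a i)) /=.
pose phi j : {a : 'I_s & 'I_(k a)} :=
  Tagged (fun a => 'I_(k a)) (Ordinal (chain_index_lt kf j)).
have phi_surj p : exists j, phi j = p.
  case: p => a i; have [j ej] : exists j, f j = (a, nat_of_ord i).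
    by apply/(proj2 kf).
  exists j; rewrite /phi; move: (chain_index_lt kf j); rewrite ej /= => lt.
  by congr (Tagged _ _); apply: val_inj.
have [psi psiK] := choice phi_surj.
rewrite (reindex phi); first by apply: eq_bigr => j _.
exists psi => p _; last exact: psiK.
have e : phi (psi (phi p)) = phi p by exact: psiK.
apply: (proj1 kf); have e1 := congr1 tag e.
have /= e2 := congr1 (fun x : {a : 'I_s & 'I_(k a)} => (tag x, nat_of_ord (tagged x))) e.
by rewrite [LHS]surjective_pairing [RHS]surjective_pairing.
Qed.

(** This removes the subtraction in End(V) q - End(V): each chain collapses to its two ends, and the
    negative ends [c b] will cancel against a framing term of the tangent space. *)
Lemma chain_telescope (m : nat) (chi cq : char m) (c : 'I_s -> char m) :
  \sum_j ((c (f j).1 + cq *+ (f j).2.+1 == chi)%:Z -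
          (c (f j).1 + cq *+ (f j).2 == chi)%:Z) =
  \sum_b ((c b + cq *+ k b == chi)%:Z - (c b == chi)%:Z).
Proof.
rewrite (big_chain _ (fun b i => (c b + cq *+ i.+1 == chi)%:Z -
                                 (c b + cq *+ i == chi)%:Z)).
apply: eq_bigr => b _.
rewrite -(big_mkord predT (fun i => (c b + cq *+ i.+1 == chi)%:Z -
                                 (c b + cq *+ i == chi)%:Z)).
by rewrite telescope_sumr // mulr0n addr0.
Qed.

End ChainSums.

Section Weights.
Context {C : numClosedFieldType} {r0 r1 n : nat}.
Let r := (r0 + r1)%N.
Implicit Types (X : triple C r0 r1 n) (d : 'I_n -> char (tdim r)).
Let cq : char (tdim r) := coord_char (iq r).
Let e0 (a : 'I_r0) : char (tdim r) := coord_char (ie (lshift r1 a)).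
Let e1 (a : 'I_r1) : char (tdim r) := coord_char (ie (rshift r0 a)).
Let mu0 (a : 'I_r0) : char (tdim r) := coord_char (imu (lshift r1 a)).
Let mu1 (a : 'I_r1) : char (tdim r) := coord_char (imu (rshift r0 a)).
Let ev := char_eval (@tvar (tdim r)).

Lemma EuK_sum2 (a b c d : finType) (u : a -> b -> char (tdim r)) (v : c -> d -> char (tdim r))
    (K : kclass (tdim r)) :
  (forall w, K w = \sum_i \sum_j (u i j == w)%:Z + \sum_i \sum_j (v i j == w)%:Z) ->
  EuK K = (\prod_i \prod_j (1 - (ev (u i j))^-1)) *
          (\prod_i \prod_j (1 - (ev (v i j))^-1)).
Proof.
move=> KE; have -> : K = fun w => \sum_(p : (a * b) + (c * d))
    ((match p with inl p => u p.1 p.2 | inr p => v p.1 p.2 end) == w)%:Z.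
  by apply/funext => w; rewrite KE big_sumType /= !pair_big.
by rewrite EuK_sum big_sumType /= !pair_big.
Qed.

Lemma EuK_Lambda X d :
  (forall chi, taut_class X chi = \sum_j (d j == chi)%:Z) ->
  EuK (Lambda_fund X) =
  (\prod_a \prod_j (1 - (ev (d j + (mu0 a - cq)))^-1)) *
  (\prod_a \prod_j (1 - (ev (- d j + (cq - mu1 a)))^-1)).
Proof.
move=> tX; apply: EuK_sum2 => w; rewrite /Lambda_fund /kadd /ksum /ktwist /kdual.
congr (_ + _); apply: eq_bigr => a _; rewrite tX; apply: eq_bigr => j _.
  by rewrite [in RHS]eq_sym -[in RHS]subr_eq eq_sym.
by rewrite -eqr_oppLR [in RHS]eq_sym -[in RHS]subr_eq eq_sym.
Qed.

Section Models.
Context (X0 : triple C r0 r1 n) (h : 'M[C]_n) (d : 'I_n -> char (tdim r)).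
Hypotheses (uh : h \in unitmx) (rX : rigid (gl_act h X0)) (dX : diag_fixed d X0).

(** For fixed [i], the [d i - d j] advance by [cq] along the chain of [j], starting at [d i - e0 a];
    the negative ends cancel Hom(W_0, V). *)
Lemma EuK_tangent_minus (k : 'I_r0 -> nat) (f : 'I_n -> 'I_r0 * nat) :
  chain_index k f -> (forall j, d j = e0 (f j).1 - cq *+ (f j).2) ->
  EuK (tangent_class (gl_act h X0)) =
  (\prod_j \prod_a (1 - (ev (d j - e0 a + cq *+ k a))^-1)) *
  (\prod_a \prod_j (1 - (ev (cq + e1 a - d j))^-1)).
Proof.
move=> kf dE; apply: EuK_sum2 => w; rewrite (tangent_class_diag uh rX dX).
rewrite !big_sumType /= [LHS]addrAC; congr (_ + _); last by rewrite pair_bigA.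
rewrite -(pair_bigA _ (fun i j => (cq + (d i - d j) == w)%:Z)) /=.
rewrite -(pair_bigA _ (fun i a => (d i - e0 a == w)%:Z)) /=.
rewrite addrAC -sumrB -big_split; apply: eq_bigr => i _ /=.
rewrite -sumrB -[RHS](subrK (\sum_a (d i - e0 a == w)%:Z)); congr (_ + _).
rewrite -sumrB -(chain_telescope kf w cq (fun a => d i - e0 a)).
apply: eq_bigr => j _; rewrite (dE j) mulrS.
congr ((_ == w)%:Z - (_ == w)%:Z); last by rewrite opprB addrA addrAC.
by rewrite opprB addrCA -[RHS]addrA [X in _ + X = _]addrA [X in _ + X = _]addrC.
Qed.

(** Here the sum telescopes in the first index [i], from the starting characters [cq + e1 a - d j];
    the negative ends cancel Hom(V, W_1) q. *)
Lemma EuK_tangent_plus (k : 'I_r1 -> nat) (f : 'I_n -> 'I_r1 * nat) :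
  chain_index k f -> (forall j, d j = e1 (f j).1 + cq *+ (f j).2.+1) ->
  EuK (tangent_class (gl_act h X0)) =
  (\prod_j \prod_a (1 - (ev (cq + e1 a - d j + cq *+ k a))^-1)) *
  (\prod_a \prod_j (1 - (ev (d j - e0 a))^-1)).
Proof.
move=> kf dE; apply: EuK_sum2 => w; rewrite (tangent_class_diag uh rX dX).
rewrite !big_sumType /=.
rewrite -(pair_bigA _ (fun i j => (cq + (d i - d j) == w)%:Z)) /=.
rewrite -(pair_bigA _ (fun i a => (d i - e0 a == w)%:Z)) /=.
rewrite -(pair_bigA _ (fun a j => (cq + e1 a - d j == w)%:Z)) /=.
set A := \sum_i \sum_j _; set B := \sum_i \sum_j _; set D := \sum_i \sum_j _.
set E := \sum_i \sum_j _.
have -> : A + B + D - E = (A - E + D) + B by ring.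
congr (_ + _); last exact: exchange_big.
rewrite [A]exchange_big [D]exchange_big [E]exchange_big -sumrB /=.
rewrite -big_split; apply: eq_bigr => j _ /=.
rewrite -sumrB -[RHS](subrK (\sum_a (cq + e1 a - d j == w)%:Z)); congr (_ + _).
rewrite -sumrB -(chain_telescope kf w cq (fun a => cq + e1 a - d j)).
apply: eq_bigr => i _; rewrite (dE i) mulrS.
congr ((_ == w)%:Z - (_ == w)%:Z); last by rewrite addrCA addrA [LHS]addrAC.
by rewrite addrA (addrA cq) [LHS]addrAC.
Qed.

End Models.

End Weights.

(** * Models of the fixed points for the two stability conditions *)

Lemma chain_shape_inj (C : numClosedFieldType) (r0 r1 n : nat)
    (X : triple C r0 r1 n) (k k' : 'I_r0 -> nat) :
  chain_shape X k -> chain_shape X k' -> k =1 k'.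
Proof.
move=> sk sk' a; have e i : (i < k a)%N = (i < k' a)%N by rewrite -sk -sk'.
case: (ltngtP (k a) (k' a)) => // lt; first by have := e (k a); rewrite ltnn lt.
by have := e (k' a); rewrite ltnn lt.
Qed.

Lemma euclid_uniq (M u v i j : nat) : (i < M)%N -> (j < M)%N ->
  (M * u + i = M * v + j)%N -> u = v /\ i = j.
Proof.
move=> iM jM e; have M0 : (0 < M)%N by apply: leq_ltn_trans iM.
have := congr1 (divn^~ M) e; have := congr1 (modn^~ M) e.
by rewrite /= !(mulnC M) !modnMDl !divnMDl // !modn_small // !divn_small // !addn0.
Qed.

Section Models.
Context {C : numClosedFieldType} {r0 r1 n : nat}.
Let r := (r0 + r1)%N.
Let two : C := 2%:R.
Let M := n.+2.

(* The weights q^-i e_a with i <= n take distinct values at this point. *)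
Definition pow2_point (i : 'I_(tdim r)) : C :=
  match split i with
  | inl _ => two
  | inr j => match split j with inl a => two ^+ (M * a) | inr _ => 1 end
  end.

Lemma pow2_point_q : pow2_point (iq r) = two.
Proof. by rewrite /pow2_point /iq (unsplitK (inl _)). Qed.

Lemma pow2_point_e (a : 'I_r) : pow2_point (ie a) = two ^+ (M * a).
Proof. by rewrite /pow2_point /ie (unsplitK (inr _)) (unsplitK (inl _)). Qed.

Lemma two_neq0 : two != 0. Proof. by rewrite pnatr_eq0. Qed.

Lemma pow2_point_torus : torus pow2_point.
Proof.
move=> i; rewrite /pow2_point; case: (split i) => [_|j]; first exact: two_neq0.
by case: (split j) => a; rewrite ?oner_eq0 // expf_neq0 // two_neq0.
Qed.

Lemma two_expn_inj (a b : nat) : two ^+ a = two ^+ b -> a = b.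
Proof. by move=> e; have [] : a%:Z = b%:Z by apply: (@two_expz_inj C); exact: e. Qed.

Lemma minus_normal_form (X : triple C r0 r1 n) : generating X ->
  (forall t, torus t -> exists2 g, g \in unitmx & gl_act g (torus_act t X) = X) ->
  exists k : {ffun 'I_r0 -> 'I_n.+1}, (\sum_i k i)%N = n /\
    forall f, chain_index (fun i => k i) f ->
      exists2 h, h \in unitmx & X = gl_act h (chain_triple f).
Proof.
move=> gX /(_ _ pow2_point_torus) [g ug]; rewrite torus_actE => gtX.
have two0 := two_neq0.
have [|a|[a i] [b j]|a b i|k [kn _ kX]] := chain_normal_form ug gtX gX.
- by rewrite pow2_point_q.
- by rewrite pow2_point_e invr_eq0 expf_neq0.
(* After cross-multiplication the exponents are [M b + i] and [M a + j], with [i] and [j] below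
   [M]. *)
- rewrite /= !pow2_point_e pow2_point_q ![_^-1 * _]mulrC => /eqP.
  rewrite eqr_div ?expf_neq0 // -!exprD /= => /eqP/two_expn_inj e.
  have [/val_inj-> /val_inj->//] : nat_of_ord b = a /\ nat_of_ord i = j.
  by apply: (@euclid_uniq M); rewrite ?ltnS ?leqW -1?ltnS // addnC e addnC.
(* The scalar is 2 to the power [1 + M (r0 + b) + i - M a], which is positive as the indices in J_0
   precede those in J_1. *)
- rewrite !pow2_point_e pow2_point_q -exprS mulrAC -exprD.
  apply/eqP => /(congr1 ( *%R^~ (two ^+ (M * a)))).
  rewrite mulfVK ?expf_neq0 // mul1r => /two_expn_inj /= e.
  suff : (M * a < (M * (r0 + b)).+1 + i)%N by rewrite e ltnn.
  by rewrite addSn ltnS (leq_trans _ (leq_addr _ _)) // leq_mul2l ltnW ?orbT //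
    ltn_addr.
- by exists k.
Qed.

Lemma plus_normal_form (X : triple C r0 r1 n) : generating (dual_triple X) ->
  (forall t, torus t -> exists2 g, g \in unitmx & gl_act g (torus_act t X) = X) ->
  exists k : {ffun 'I_r1 -> 'I_n.+1}, (\sum_i k i)%N = n /\
    forall f, chain_index (fun i => k i) f ->
      exists2 h, h \in unitmx & X = gl_act h (dual_triple (chain_triple f)).
Proof.
move=> gX /(_ _ pow2_point_torus) [g ug]; rewrite torus_actE.
move/(congr1 dual_triple); rewrite dual_gl_act dual_scale_act => gtX.
have ug' : (invmx g)^T \in unitmx by rewrite unitmx_tr unitmx_inv.
have two0 := two_neq0.
have [|a|[a i] [b j]|b a i|k [kn _ kX]] := chain_normal_form ug' gtX gX.
- by rewrite pow2_point_q.
- by rewrite pow2_point_q pow2_point_e mulf_neq0 ?expf_neq0.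
- rewrite /= !pow2_point_e pow2_point_q -!exprS -!exprD => /two_expn_inj [] e.
  have [/addnI/val_inj-> /val_inj->//] : (r0 + a = r0 + b)%N /\ nat_of_ord i = j.
  by apply: (@euclid_uniq M); rewrite ?ltnS ?leqW -1?ltnS.
- rewrite !pow2_point_e pow2_point_q -exprS mulrAC -mulrA -exprD mulrC.
  apply/eqP => /(congr1 ( *%R^~ (two ^+ (M * a)))).
  rewrite mulfVK ?expf_neq0 // mul1r => /two_expn_inj /= e.
  suff : (M * a < (M * (r0 + b)).+1 + i)%N by rewrite addnC e ltnn.
  by rewrite addSn ltnS (leq_trans _ (leq_addr _ _)) // leq_mul2l ltnW ?orbT //
    ltn_addr.
exists k; split=> // f kf; have [h uh hX] := kX f kf.
exists (invmx h)^T; first by rewrite unitmx_tr unitmx_inv.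
by rewrite -dual_gl_act -hX dual_tripleK.
Qed.

Definition minus_weight (f : 'I_n -> 'I_r0 * nat) (j : 'I_n) : char (tdim r) :=
  coord_char (ie (lshift r1 (f j).1)) - coord_char (iq r) *+ (f j).2.

Lemma minus_fixed (f : 'I_n -> 'I_r0 * nat) :
  diag_fixed (minus_weight f) (chain_triple f : triple C r0 r1 n).
Proof.
move=> t tt; have t0 i : t i != 0 by exact: tt.
rewrite torus_actE (chain_scale_fixed) // => [i|j].
  by rewrite invr_eq0.
by rewrite char_evalD // char_evalN char_evalMn // !char_eval_coord invrK exprVn.
Qed.

(** The power of [q] starts at 1 because the torus scales [w] by [q e], whereas it scales [z] by
    [e^-1] alone. *)
Definition plus_weight (f : 'I_n -> 'I_r1 * nat) (j : 'I_n) : char (tdim r) :=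
  coord_char (ie (rshift r0 (f j).1)) + coord_char (iq r) *+ (f j).2.+1.

Lemma plus_fixed (f : 'I_n -> 'I_r1 * nat) :
  diag_fixed (plus_weight f) (dual_triple (chain_triple f) : triple C r0 r1 n).
Proof.
move=> t tt; have t0 i : t i != 0 by exact: tt.
have c0 j : char_eval t (plus_weight f j) != 0 by exact: char_eval_neq0.
apply: (can_inj (@dual_tripleK C r0 r1 n)).
rewrite torus_actE dual_gl_act dual_scale_act dual_tripleK.
rewrite (invmx_diag c0) tr_diag_mx (chain_scale_fixed) // => [i|j].
  by rewrite mulf_neq0.
rewrite /= char_evalD // char_evalMn // !char_eval_coord.
by rewrite exprS exprVn mulrA -invfM (mulrC (t (ie _))).
Qed.

End Models.

(** * Fixed-point contributions *)

Section Genericity.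
Context {r : nat}.
Let q : ratfun (tdim r) := tvar (iq r).
Let e (a : 'I_r) : ratfun (tdim r) := tvar (ie a).

Lemma iq_neq_ie (a : 'I_r) : (iq r == ie a) = false.
Proof. by apply/eqP => /(congr1 val). Qed.

Lemma tvar_q_unity_free i : q ^+ i.+1 != 1.
Proof.
apply/eqP => qi; have : coord_char (iq r) *+ i.+1 = 0.
  apply: char_eval_tvar_eq1.
  by rewrite char_evalMn ?char_eval_coord //; apply: tvar_neq0.
by move/ffunP/(_ (iq r)); rewrite ffunMnE !ffunE eqxx natz.
Qed.

(** Whatever [l], the monomial has exponent 1 at [e a], so its character is nontrivial. *)
Lemma tvar_ratio_generic (a b : 'I_r) (l : int) :
  a != b -> q ^ l * (e a / e b) != 1.
Proof.
move=> ab; apply/eqP => ql.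
have t0 i : tvar i != 0 :> ratfun (tdim r) by exact: tvar_neq0.
pose qc := match l with
  | Posz i => coord_char (iq r) *+ i
  | Negz i => - (coord_char (iq r) *+ i.+1) end.
have : qc + (coord_char (ie a) - coord_char (ie b)) = 0.
  apply: char_eval_tvar_eq1; rewrite !char_evalD // char_evalN !char_eval_coord.
  rewrite -[RHS]ql; congr (_ * _); rewrite /qc; case: l {ql qc} => i.
    by rewrite char_evalMn // char_eval_coord.
  by rewrite char_evalN char_evalMn // char_eval_coord.
move/ffunP/(_ (ie a)); rewrite !ffunE eqxx.
have -> : qc (ie a) = 0.
  by rewrite /qc; case: l {ql qc} => i; rewrite ?ffunE ffunMnE ffunE iq_neq_ie mul0rn ?oppr0.
have -> : (ie b == ie a) = false.
  by apply/eqP => /rshift_inj/lshift_inj e'; rewrite e' eqxx in ab.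
by [].
Qed.

End Genericity.

Section FieldTerms.
Context {F : fieldType} {r0 r1 n : nat} {q : F}.
Context {e0 mu0 : 'I_r0 -> F} {e1 mu1 : 'I_r1 -> F}.
Hypotheses (q0 : q != 0) (e00 : forall a, e0 a != 0) (e10 : forall a, e1 a != 0)
  (mu00 : forall a, mu0 a != 0) (mu10 : forall a, mu1 a != 0)
  (q1 : forall i, q ^+ i.+1 != 1).

Let qi (i : nat) : q ^+ i != 0.
Proof. by rewrite expf_neq0. Qed.

Let nz := (q0, qi, e00, e10, mu00, mu10, oner_eq0 F).

(** [fixed_point_term] at [x = e0^-1], with the products over basis vectors regrouped along chains.
    In an abstract field the coordinates are atoms for [field]. *)
Lemma minus_term_field (k : 'I_r0 -> nat) (f : 'I_n -> 'I_r0 * nat)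
    (D := fun j => e0 (f j).1 / q ^+ (f j).2) :
  chain_index k f -> (\sum_a k a)%N = n ->
  (forall a b (l : int), a != b -> q ^ l * (e0 a / e0 b) != 1) ->
  ((\prod_a \prod_j (1 - (D j * (mu0 a / q))^-1)) *
   (\prod_a \prod_j (1 - ((D j)^-1 * (q / mu1 a))^-1))) /
  ((\prod_j \prod_a (1 - (D j / e0 a * q ^+ k a)^-1)) *
   (\prod_a \prod_j (1 - (q * e1 a / D j)^-1))) =
  (- \prod_(a < r1) (e1 a * mu1 a)) ^+ n * q ^+ (n * n.+1)./2
   * (Delta (fun b => q ^+ k b * (e0 b)^-1) / Delta (fun b => (e0 b)^-1))
   * (\prod_(a < r0) \prod_(b < r0)
        (qpoch q (q / (e0 b * mu0 a)) (k b) / qpoch q (q * e0 a / e0 b) (k b)))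
   * (\prod_(b < r0) \prod_(a < r1)
        (qpoch q (q / (e0 b * mu1 a)) (k b) / qpoch q (q * e1 a / e0 b) (k b))).
Proof.
move=> kf kn e_gen.
have x0 a : (e0 a)^-1 != 0 by rewrite invr_eq0.
have x_gen (a b : 'I_r0) (l : int) :
    a != b -> q ^ l * ((e0 a)^-1 / (e0 b)^-1) != 1.
  by move=> ab; rewrite [_ / _]mulrC invrK e_gen // eq_sym.
have m0 a : q / mu1 a != 0 by rewrite mulf_neq0 ?invr_eq0.
have := fixed_point_term q0 (fun a => q / mu0 a) k q1 x0 x_gen m0 e10.
rewrite kn => main; apply: etrans (etrans main _); last first.
  congr ((- _) ^+ n * _ * _ * _ * _).
  - by apply: eq_bigr => a _; field; rewrite !nz.
  - apply: eq_bigr => a _; apply: eq_bigr => b _.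
    by congr (qpoch q _ _ / qpoch q _ _); field; rewrite !nz.
  - apply: eq_bigr => b _; apply: eq_bigr => a _.
    by congr (qpoch q _ _ / qpoch q _ _); field; rewrite !nz.
congr ((_ * _) / (_ * _)).
- apply: eq_bigr => a _.
  rewrite -(big_chain kf _ (fun b i => 1 - q ^+ i * ((e0 b)^-1 * (q / mu0 a)))).
  apply: eq_bigr => j _; rewrite /D.
  by congr (1 - _); field; rewrite !nz.
- apply: eq_bigr => a _.
  rewrite -(big_chain kf _ (fun b i => 1 - (q ^+ i * ((e0 b)^-1 * (q / mu1 a)))^-1)).
  apply: eq_bigr => j _; rewrite /D.
  by congr (1 - _); field; rewrite !nz.
- rewrite exchange_big; apply: eq_bigr => a _.
  rewrite -(big_chain kf _ (fun b i =>
    1 - q ^ (i%:Z - (k a)%:Z) * ((e0 b)^-1 / (e0 a)^-1))).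
  apply: eq_bigr => j _; rewrite /D expfzDr // -exprnP -exprnN.
  by congr (1 - _); field; rewrite !nz.
- apply: eq_bigr => a _.
  rewrite -(big_chain kf _ (fun b i => 1 - (q ^+ i * (q * (e0 b)^-1 * e1 a))^-1)).
  apply: eq_bigr => j _; rewrite /D.
  by congr (1 - _); field; rewrite !nz.
Qed.

Lemma plus_term_field (k : 'I_r1 -> nat) (f : 'I_n -> 'I_r1 * nat)
    (D := fun j => e1 (f j).1 * q ^+ (f j).2.+1) :
  chain_index k f -> (\sum_a k a)%N = n ->
  (forall a b (l : int), a != b -> q ^ l * (e1 a / e1 b) != 1) ->
  ((\prod_a \prod_j (1 - (D j * (mu0 a / q))^-1)) *
   (\prod_a \prod_j (1 - ((D j)^-1 * (q / mu1 a))^-1))) /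
  ((\prod_j \prod_a (1 - (q * e1 a / D j * q ^+ k a)^-1)) *
   (\prod_a \prod_j (1 - (D j / e0 a)^-1))) =
  (- \prod_(a < r0) (q / (e0 a * mu0 a))) ^+ n * q ^+ (n * n.+1)./2
   * (Delta (fun b => q ^+ k b * e1 b) / Delta e1)
   * (\prod_(a < r1) \prod_(b < r1)
        (qpoch q (e1 b * mu1 a) (k b) / qpoch q (q * e1 b / e1 a) (k b)))
   * (\prod_(b < r1) \prod_(a < r0)
        (qpoch q (e1 b * mu0 a) (k b) / qpoch q (q * e1 b / e0 a) (k b))).
Proof.
move=> kf kn e_gen.
have c0 a : (e0 a)^-1 != 0 by rewrite invr_eq0.
have := fixed_point_term q0 mu1 k q1 e10 e_gen mu00 c0.
rewrite kn => main; apply: etrans (etrans main _); last first.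
  congr ((- _) ^+ n * _ * _ * _ * _).
  by apply: eq_bigr => a _; field; rewrite !nz.
(* With the chains now over J_1, the dual part of the fundamental class supplies the first product
   of [fixed_point_term]. *)
rewrite [X in X / _]mulrC; congr ((_ * _) / (_ * _)).
- apply: eq_bigr => a _.
  rewrite -(big_chain kf _ (fun b i => 1 - q ^+ i * (e1 b * mu1 a))).
  apply: eq_bigr => j _; rewrite /D exprS.
  by congr (1 - _); field; rewrite !nz.
- apply: eq_bigr => a _.
  rewrite -(big_chain kf _ (fun b i => 1 - (q ^+ i * (e1 b * mu0 a))^-1)).
  apply: eq_bigr => j _; rewrite /D exprS.
  by congr (1 - _); field; rewrite !nz.
- rewrite exchange_big; apply: eq_bigr => a _.
  rewrite -(big_chain kf _ (fun b i =>
    1 - q ^ (i%:Z - (k a)%:Z) * (e1 b / e1 a))).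
  apply: eq_bigr => j _; rewrite /D exprS expfzDr // -exprnP -exprnN.
  by congr (1 - _); field; rewrite !nz.
- apply: eq_bigr => a _.
  rewrite -(big_chain kf _ (fun b i => 1 - (q ^+ i * (q * e1 b / e0 a))^-1)).
  apply: eq_bigr => j _; rewrite /D exprS.
  by congr (1 - _); field; rewrite !nz.
Qed.

End FieldTerms.

Section Terms.
Context {C : numClosedFieldType} {r0 r1 n : nat}.
Let r := (r0 + r1)%N.
Let q : ratfun (tdim r) := tvar (iq r).
Let e0 (a : 'I_r0) : ratfun (tdim r) := tvar (ie (lshift r1 a)).
Let e1 (a : 'I_r1) : ratfun (tdim r) := tvar (ie (rshift r0 a)).
Let mu0 (a : 'I_r0) : ratfun (tdim r) := tvar (imu (lshift r1 a)).
Let mu1 (a : 'I_r1) : ratfun (tdim r) := tvar (imu (rshift r0 a)).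
Let t0 (i : 'I_(tdim r)) : tvar i != 0 := tvar_neq0 i.

Definition minus_summand (k : 'I_r0 -> nat) : ratfun (tdim r) :=
  (- \prod_(a < r1) (e1 a * mu1 a)) ^+ n * q ^+ (n * n.+1)./2
   * (Delta (fun b => q ^+ k b * (e0 b)^-1) / Delta (fun b => (e0 b)^-1))
   * (\prod_(a < r0) \prod_(b < r0)
        (qpoch q (q / (e0 b * mu0 a)) (k b) / qpoch q (q * e0 a / e0 b) (k b)))
   * (\prod_(b < r0) \prod_(a < r1)
        (qpoch q (q / (e0 b * mu1 a)) (k b) / qpoch q (q * e1 a / e0 b) (k b))).

Lemma minus_term (k : 'I_r0 -> nat) (f : 'I_n -> 'I_r0 * nat) (h : 'M[C]_n)
    (X := gl_act h (chain_triple f) : triple C r0 r1 n) :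
  chain_index k f -> h \in unitmx -> (\sum_a k a)%N = n ->
  EuK (Lambda_fund X) / EuK (tangent_class X) = minus_summand k.
Proof.
move=> kf uh kn.
have rX : rigid X.
  exact/generating_rigid/(generating_gl uh)/(chain_generating kf).
have dX := minus_fixed (C := C) (r1 := r1) f.
have e_gen (a b : 'I_r0) (l : int) : a != b -> q ^ l * (e0 a / e0 b) != 1.
  move=> ab; have ab' : lshift r1 a != lshift r1 b.
    by rewrite (inj_eq (@lshift_inj _ _)).
  exact: (@tvar_ratio_generic r _ _ l ab').
rewrite (EuK_Lambda (taut_class_diag uh rX dX)).
rewrite (EuK_tangent_minus uh rX dX kf (fun=> erefl)).
rewrite /minus_summand -(minus_term_field (t0 _) (fun a => t0 _) (fun a => t0 _)
  (fun a => t0 _) (fun a => t0 _) (@tvar_q_unity_free r) kf kn e_gen).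
congr ((_ * _) / (_ * _)); apply: eq_bigr => i _; apply: eq_bigr => j _;
  by rewrite /minus_weight !(char_evalD _ _ t0, char_evalN, char_evalMn _ _ t0,
    char_eval_coord).
Qed.

Definition plus_summand (k : 'I_r1 -> nat) : ratfun (tdim r) :=
  (- \prod_(a < r0) (q / (e0 a * mu0 a))) ^+ n * q ^+ (n * n.+1)./2
   * (Delta (fun b => q ^+ k b * e1 b) / Delta e1)
   * (\prod_(a < r1) \prod_(b < r1)
        (qpoch q (e1 b * mu1 a) (k b) / qpoch q (q * e1 b / e1 a) (k b)))
   * (\prod_(b < r1) \prod_(a < r0)
        (qpoch q (e1 b * mu0 a) (k b) / qpoch q (q * e1 b / e0 a) (k b))).

Lemma plus_term (k : 'I_r1 -> nat) (f : 'I_n -> 'I_r1 * nat) (h : 'M[C]_n)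
    (X := gl_act h (dual_triple (chain_triple f)) : triple C r0 r1 n) :
  chain_index k f -> h \in unitmx -> (\sum_a k a)%N = n ->
  EuK (Lambda_fund X) / EuK (tangent_class X) = plus_summand k.
Proof.
move=> kf uh kn.
have rX : rigid X.
  apply/dual_rigid/generating_rigid; rewrite /X dual_gl_act dual_tripleK.
  by apply/generating_gl/(chain_generating kf); rewrite unitmx_tr unitmx_inv.
have dX := plus_fixed (C := C) (r0 := r0) f.
have e_gen (a b : 'I_r1) (l : int) : a != b -> q ^ l * (e1 a / e1 b) != 1.
  move=> ab; have ab' : rshift r0 a != rshift r0 b.
    by rewrite (inj_eq (@rshift_inj _ _)).
  exact: (@tvar_ratio_generic r _ _ l ab').
rewrite (EuK_Lambda (taut_class_diag uh rX dX)).
rewrite (EuK_tangent_plus uh rX dX kf (fun=> erefl)).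
rewrite /plus_summand -(plus_term_field (t0 _) (fun a => t0 _) (fun a => t0 _)
  (fun a => t0 _) (fun a => t0 _) (@tvar_q_unity_free r) kf kn e_gen).
congr ((_ * _) / (_ * _)); apply: eq_bigr => i _; apply: eq_bigr => j _;
  by rewrite /plus_weight !(char_evalD _ _ t0, char_evalN, char_evalMn _ _ t0,
    char_eval_coord).
Qed.

End Terms.

Unset Implicit Arguments.

(* The coefficient of p^n on both sides; (q^((n+1)/2))^n = q^(n(n+1)/2). *)
Theorem theorem5p8 (C : numClosedFieldType) (r0 r1 : nat) :
  let r := (r0 + r1)%N in
  let q : ratfun (tdim r) := tvar (iq r) in
  let e0 (a : 'I_r0) : ratfun (tdim r) := tvar (ie (lshift r1 a)) in
  let e1 (a : 'I_r1) : ratfun (tdim r) := tvar (ie (rshift r0 a)) in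
  let mu0 (a : 'I_r0) : ratfun (tdim r) := tvar (imu (lshift r1 a)) in
  let mu1 (a : 'I_r1) : ratfun (tdim r) := tvar (imu (rshift r0 a)) in
  (forall n : nat,
     Z_plus_fund C r0 r1 n =
     \sum_(k : {ffun 'I_r1 -> 'I_n.+1} | (\sum_b k b)%N == n)
       ((- \prod_(a < r0) (q / (e0 a * mu0 a))) ^+ n * q ^+ (n * n.+1)./2
        * (Delta (fun b => q ^+ k b * e1 b) / Delta e1)
        * (\prod_(a < r1) \prod_(b < r1)
             (qpoch q (e1 b * mu1 a) (k b) / qpoch q (q * e1 b / e1 a) (k b)))
        * (\prod_(b < r1) \prod_(a < r0)
             (qpoch q (e1 b * mu0 a) (k b) / qpoch q (q * e1 b / e0 a) (k b)))))
  /\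
  (forall n : nat,
     Z_minus_fund C r0 r1 n =
     \sum_(k : {ffun 'I_r0 -> 'I_n.+1} | (\sum_b k b)%N == n)
       ((- \prod_(a < r1) (e1 a * mu1 a)) ^+ n * q ^+ (n * n.+1)./2
        * (Delta (fun b => q ^+ k b * (e0 b)^-1) / Delta (fun b => (e0 b)^-1))
        * (\prod_(a < r0) \prod_(b < r0)
             (qpoch q (q / (e0 b * mu0 a)) (k b)
              / qpoch q (q * e0 a / e0 b) (k b)))
        * (\prod_(b < r0) \prod_(a < r1)
             (qpoch q (q / (e0 b * mu1 a)) (k b)
              / qpoch q (q * e1 a / e0 b) (k b))))).
Proof.
split=> n.
- apply: (@K_integral_chains C r0 r1 n r1 _ _
    (fun f => dual_triple (chain_triple f)) (@plus_summand r0 r1 n)).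
  + move=> X h sX uh fX; apply: plus_normal_form => //.
    rewrite dual_gl_act; apply: generating_gl (stable_plus_generating sX).
    by rewrite unitmx_tr unitmx_inv.
  + move=> k f kf; apply: generating_stable_plus; rewrite dual_tripleK.
    exact: chain_generating kf.
  + by move=> k f kf; exists (plus_weight f); apply: plus_fixed.
  (* Dualizing reduces the comparison to the chain triples themselves, whose Krylov vectors recover
     [k]. *)
  + move=> k k' f f' h kf kf' uh /(congr1 dual_triple).
    rewrite dual_gl_act !dual_tripleK => e.
    apply: (chain_shape_inj (X := chain_triple f : triple C r1 r0 n)).
      by rewrite -[chain_triple f]gl_act1; apply: chain_shape_gl; rewrite ?unitmx1.
    by rewrite e; apply: chain_shape_gl; rewrite // unitmx_tr unitmx_inv.
  + by move=> k f h kf uh kn; apply: plus_term.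
- apply: (@K_integral_chains C r0 r1 n r0 _ _
    (fun f => chain_triple f) (@minus_summand r0 r1 n)).
  + move=> X h sX uh fX; apply: minus_normal_form => //.
    exact: generating_gl (stable_minus_generating sX).
  + by move=> k f; apply: chain_stable_minus.
  + by move=> k f kf; exists (minus_weight f); apply: minus_fixed.
  + move=> k k' f f' h kf kf' uh e.
    apply: (chain_shape_inj (X := chain_triple f : triple C r0 r1 n)).
      by rewrite -[chain_triple f]gl_act1; apply: chain_shape_gl; rewrite ?unitmx1.
    by rewrite e; apply: chain_shape_gl.
  + by move=> k f h kf uh kn; apply: minus_term.
Qed.
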